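(* Let $K\in\mathbb{R}$ and $K_s>0$. For every trajectory $\{\theta(t)\}_{t\in[0,\infty)}$ in $\Theta$ of $$\partial_t\theta(x)=v_\theta(\theta(x)),\qquad v_\theta(\phi)=K\int_0^1\sin(\phi-\theta(y))\,\mathrm{d}y-K_s\sin(2\phi)\quad(\phi\in\mathbb{T}),$$ the set of accumulation points of the trajectory is a nonempty, compact, connected subset of $\Theta$ consisting of fixed points of the dynamics, and it is contained in a single level set of the energy $$E(\theta)=\frac K2\int_0^1\!\!\int_0^1\cos(\theta(x)-\theta(y))\,\mathrm{d}x\,\mathrm{d}y-\frac{K_s}{2}\int_0^1\cos(2\theta(x))\,\mathrm{d}x.$$
   Context: $\mathbb{T}=\mathbb{R}/2\pi\mathbb{Z}$. $\Theta$ is the set of measurable functions $\theta:[0,1]\to\mathbb{T}$ modulo almost-everywhere equality, with metric $d_\Theta(\theta,\phi)=\big(\int_0^1 |\theta(x)-\phi(x)|_{\mathbb{T}}^2\,\mathrm{d}x\big)^{1/2}$, where $|\cdot|_{\mathbb{T}}$ is the distance to $0$ in $\mathbb{T}$. A trajectory is a curve $\theta(t)=\theta_0+u(t)$ (mod $2\pi$) with $\theta_0\in\Theta$, $u\in C^1([0,\infty);L^2([0,1];\mathbb{R}))$, $u(0)=0$, satisfying the differential equation with $\partial_t\theta:=\partial_t u$. A fixed point is a $\theta\in\Theta$ such that $v_\theta(\theta(x))=0$ for a.e. $x$. An accumulation point of the trajectory is a $\theta^*\in\Theta$ for which there exist $t_n\to\infty$ with $\theta(t_n)\to\theta^*$ in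 $\Theta$. *)

(* Defs.v *)
From HB Require Import structures.
From mathcomp Require Import all_boot all_order all_algebra.
From mathcomp Require Import generic_quotient ring_quotient.
From mathcomp Require Import all_classical all_reals all_analysis.
From mathcomp Require Import measurable_realfun lra.

Set Implicit Arguments.
Unset Strict Implicit.
Unset Printing Implicit Defensive.

Import Order.TTheory GRing.Theory Num.Theory.
Import numFieldNormedType.Exports.

Local Open Scope classical_set_scope.
Local Open Scope quotient_scope.
Local Open Scope ring_scope.

Section circle.
Variable R : realType.

Definition two_pi_int : {pred R} :=
  [pred x : R | `[< exists k : int, x = (pi *+ 2) * k%:~R >]].

Lemma two_pi_int_zmod_closed : zmod_closed two_pi_int.
Proof.
split=> [|_ _ /asboolP[k ->] /asboolP[l ->]]; apply/asboolP.
  by exists 0; rewrite mulr0.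
by exists (k - l); rewrite rmorphB mulrBr.
Qed.

HB.instance Definition _ :=
  GRing.isZmodClosed.Build R two_pi_int two_pi_int_zmod_closed.

(* The quotient group R / 2 pi Z, with the quotient topology and its Borel
   sigma-algebra. *)
Definition circle : Type := Quotient.quot two_pi_int.
HB.instance Definition _ := GRing.Zmodule.on circle.
HB.instance Definition _ := Quotient.on circle.

Definition circle_open (U : set circle) : Prop := open (\pi_circle @^-1` U).

Lemma circle_openT : circle_open setT.
Proof. by rewrite /circle_open preimage_setT; exact: openT. Qed.

Lemma circle_openI : setI_closed circle_open.
Proof. by move=> U V oU oV; exact: openI. Qed.

Lemma circle_open_bigU (I : Type) (U : I -> set circle) :
  (forall i, circle_open (U i)) -> circle_open (\bigcup_i U i).
Proof.
by move=> oU; rewrite /circle_open preimage_bigcup; apply: bigcup_open => i _;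
  exact: oU.
Qed.

HB.instance Definition _ :=
  @isOpenTopological.Build circle circle_open
    circle_openT circle_openI circle_open_bigU.
HB.instance Definition _ := isPointed.Build circle 0.
HB.instance Definition _ :=
  Measurable.copy circle (g_sigma_algebraType (@open circle)).

Definition to_circle (r : R) : circle := \pi_circle r.

Lemma to_circleD r s : to_circle (r + s) = to_circle r + to_circle s.
Proof. exact: Quotient.pi_add. Qed.

Lemma to_circleN r : to_circle (- r) = - to_circle r.
Proof. exact: Quotient.pi_opp. Qed.

Lemma to_circleB r s : to_circle (r - s) = to_circle r - to_circle s.
Proof. by rewrite to_circleD to_circleN. Qed.

Lemma to_circle0 : to_circle 0 = 0.
Proof. by apply: (@addrI _ (to_circle 0)); rewrite -to_circleD !addr0. Qed.

Lemma to_circle_eq r s :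
  to_circle r = to_circle s <-> exists k : int, r = s + (pi *+ 2) * k%:~R.
Proof.
have -> : to_circle r = to_circle s <-> r - s \in two_pi_int.
  rewrite (Quotient.idealrBE (two_pi_int : zmodClosed R)).
  by split=> [rs|/eqP//]; apply/eqP.
split=> [/asboolP[k rs]|[k ->]]; first by exists k; rewrite -rs subrKC.
by apply/asboolP; exists k; rewrite addrAC subrr add0r.
Qed.

Lemma to_circle_repr (a : circle) : to_circle (repr a) = a.
Proof. exact: reprK. Qed.

Lemma measurable_to_circle :
  measurable_fun setT (to_circle : measurableTypeR R -> circle).
Proof.
apply: (measurability (@open circle)) => // _ [U oU <-].
by apply: measurableI => //; apply: open_measurable.
Qed.

(* The distance to 0 in R / 2 pi Z. *)
Definition circle_norm (a : circle) : R :=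
  inf [set `|r| | r in to_circle @^-1` [set a]].

(* sin and cos as functions on R / 2 pi Z; see circle_sinE and circle_cosE. *)
Definition circle_sin (a : circle) : R := sin (repr a).
Definition circle_cos (a : circle) : R := cos (repr a).

Lemma periodicz (f : R -> R) (T : R) : periodic f T ->
  forall (k : int) a, f (a + T * k%:~R) = f a.
Proof.
move=> fT [n|n] a; first by rewrite mulr_natr (periodicn fT).
rewrite NegzE rmorphN mulrN mulr_natr.
by rewrite -[LHS](periodicn fT n.+1) addrNK.
Qed.

Lemma circle_sinE r : circle_sin (to_circle r) = sin r.
Proof.
have /to_circle_eq[k] := to_circle_repr (to_circle r).
by rewrite /circle_sin => ->; rewrite (periodicz (@sinD2pi R)).
Qed.

Lemma circle_cosE r : circle_cos (to_circle r) = cos r.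
Proof.
have /to_circle_eq[k] := to_circle_repr (to_circle r).
by rewrite /circle_cos => ->; rewrite (periodicz (@cosD2pi R)).
Qed.

(* The representative in [0, 2 pi[. *)
Definition circle_rep (a : circle) : R :=
  repr a - (pi *+ 2) * (Num.floor (repr a / (pi *+ 2)))%:~R.

Let pi2_gt0 : 0 < pi *+ 2 :> R.
Proof. by rewrite pmulrn_lgt0// pi_gt0. Qed.

Lemma to_circle_rep a : to_circle (circle_rep a) = a.
Proof.
rewrite -[RHS]to_circle_repr; apply/to_circle_eq.
by exists (- Num.floor (repr a / (pi *+ 2))); rewrite rmorphN mulrN.
Qed.

Lemma circle_rep_itv a : 0 <= circle_rep a < pi *+ 2.
Proof.
have := Num.Theory.floor_itv (repr a / (pi *+ 2)).
rewrite ler_pdivlMr// ltr_pdivrMr// intrD mulrDl mul1r.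
rewrite /circle_rep => /andP[]; rewrite mulrC => ? ?.
rewrite subr_ge0 ltrBlDr addrC [in X in _ < X]mulrC.
by apply/andP; split=> //; lra.
Qed.


Let two_pi_le n : pi *+ 2 <= (pi *+ 2) * n.+1%:~R :> R.
Proof. by rewrite ler_pMr// (ler_nat R 1). Qed.

Lemma circle_norm_rep a :
  circle_norm a = Num.min (circle_rep a) (pi *+ 2 - circle_rep a).
Proof.
set m := Num.min _ _.
have [rep_ge0 rep_lt] := andP (circle_rep_itv a).
have m_lb : lbound [set `|r| | r in to_circle @^-1` [set a]] m.
  move=> _ [r /= ra <-].
  have /to_circle_eq[k ->] : to_circle r = to_circle (circle_rep a).
    by rewrite to_circle_rep.
  rewrite /m ge_min; case: k => n.
    apply/orP; left; apply: le_trans (ler_norm _).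
    by rewrite lerDl mulr_ge0// ?ltW// ler0z.
  apply/orP; right; rewrite -normrN; apply: le_trans (ler_norm _).
  have := two_pi_le n.
  by rewrite NegzE rmorphN mulrN => ?; lra.
have m_in : [set `|r| | r in to_circle @^-1` [set a]] m.
  rewrite /m minEle; case: ifPn => _.
    by exists (circle_rep a) => /=; [exact: to_circle_rep|rewrite ger0_norm].
  exists (circle_rep a - pi *+ 2) => /=; last first.
    by rewrite distrC gtr0_norm// subr_gt0.
  rewrite -[RHS]to_circle_rep; apply/to_circle_eq; exists (-1).
  by rewrite rmorphN mulrN mulr1.
apply/eqP; rewrite eq_le; apply/andP; split.
  by apply: ge_inf => //; exists m => x /m_lb.
by apply: lb_le_inf => [|x /m_lb//]; exists m.
Qed.

Lemma circle_normP a :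
  exists2 r, to_circle r = a &
    circle_norm a = `|r| /\ (forall s, to_circle s = a -> `|r| <= `|s|).
Proof.
have [rep_ge0 rep_lt] := andP (circle_rep_itv a).
have lb s : to_circle s = a -> circle_norm a <= `|s|.
  move=> sa; apply: ge_inf; last by exists s.
  by exists 0 => _ [r _ <-].
have [ra|ra] := leP (circle_rep a) (pi *+ 2 - circle_rep a).
  exists (circle_rep a); first exact: to_circle_rep.
  have na : circle_norm a = `|circle_rep a|.
    by rewrite circle_norm_rep min_l// ger0_norm.
  by split=> // s /lb; rewrite na.
exists (circle_rep a - pi *+ 2).
  rewrite -[RHS]to_circle_rep; apply/to_circle_eq; exists (-1).
  by rewrite rmorphN mulrN mulr1.
have na : circle_norm a = `|circle_rep a - pi *+ 2|.
  by rewrite circle_norm_rep min_r ?ltW// distrC gtr0_norm// subr_gt0.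
by split=> // s /lb; rewrite na.
Qed.

Lemma circle_norm_ge0 a : 0 <= circle_norm a.
Proof. by have [r _ [-> _]] := circle_normP a. Qed.

Lemma circle_norm_le a : circle_norm a <= pi *+ 2.
Proof.
have /andP[? ?] := circle_rep_itv a.
by rewrite circle_norm_rep ge_min ltW.
Qed.

Lemma circle_norm0 : circle_norm 0 = 0.
Proof.
have [r _ [-> /(_ 0)]] := circle_normP 0.
rewrite normr0 to_circle0 => /(_ erefl).
by rewrite normr_le0 => /eqP ->; rewrite normr0.
Qed.

Lemma circle_norm_eq0 a : circle_norm a = 0 -> a = 0.
Proof.
by have [r <- [-> _] /normr0_eq0 ->] := circle_normP a; rewrite to_circle0.
Qed.

Lemma circle_normN a : circle_norm (- a) = circle_norm a.
Proof.
suff le b : circle_norm (- b) <= circle_norm b.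
  by apply/eqP; rewrite eq_le le/= -{1}(opprK a) le.
have [r rb [-> _]] := circle_normP b.
have [s sb [-> min_s]] := circle_normP (- b).
by rewrite -(normrN r); apply: min_s; rewrite to_circleN rb.
Qed.

Lemma circle_normD a b : circle_norm (a + b) <= circle_norm a + circle_norm b.
Proof.
have [r ra [-> _]] := circle_normP a; have [s sb [-> _]] := circle_normP b.
have [t _ [-> min_t]] := circle_normP (a + b).
by apply: le_trans (ler_normD _ _); apply: min_t; rewrite to_circleD ra sb.
Qed.

Lemma circle_repK r : 0 <= r < pi *+ 2 -> circle_rep (to_circle r) = r.
Proof.
move=> /andP[r0 r2]; have := circle_rep_itv (to_circle r).
have /to_circle_eq[k ->] := to_circle_rep (to_circle r).
case: k => [[|n]|n] /andP[q0 q2]; first by rewrite mulr0 addr0.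
  by have := two_pi_le n => ?; exfalso; lra.
have := two_pi_le n; move: q0.
by rewrite NegzE rmorphN mulrN => ? ?; exfalso; lra.
Qed.

Lemma open_circle_rep_gt (c : R) : open [set a | c < circle_rep a].
Proof.
have [c0|c0] := ltP c 0.
  rewrite (_ : [set a | _] = setT); first exact: openT.
  apply/seteqP; split=> // a _ /=.
  by have /andP[a0 _] := circle_rep_itv a; exact: lt_le_trans a0.
rewrite /open/= /circle_open.
rewrite (_ : _ @^-1` _ = \bigcup_(k : int)
    `](c + (pi *+ 2) * k%:~R), (pi *+ 2 + (pi *+ 2) * k%:~R)[%classic).
  by apply: bigcup_open => k _; exact: interval_open.
apply/seteqP; split=> r /=.
  rewrite -/(to_circle r) => cr.
  have /to_circle_eq[k rE] := esym (to_circle_rep (to_circle r)).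
  exists k => //=; rewrite in_itv/= rE ltrD2r cr/= ltrD2r.
  by have /andP[] := circle_rep_itv (to_circle r).
move=> [k _] /=; rewrite in_itv/= => /andP[cr r2]; rewrite -/(to_circle r).
have -> : to_circle r = to_circle (r - (pi *+ 2) * k%:~R).
  by apply/to_circle_eq; exists k; rewrite subrK.
by rewrite circle_repK; [lra|apply/andP; split; lra].
Qed.

Lemma measurable_circle_rep : measurable_fun setT circle_rep.
Proof.
apply: (measurability _ (RGenOInfty.measurableE R)) => //.
move=> _ [_ [x ->] <-]; rewrite preimage_itvoy; apply: measurableI => //.
by apply: sub_sigma_algebra; exact: open_circle_rep_gt.
Qed.

Lemma measurable_circle_norm : measurable_fun setT circle_norm.
Proof.
rewrite (_ : circle_norm =
    fun a => Num.min (circle_rep a) (pi *+ 2 - circle_rep a)); last first.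
  by apply/funext => a; exact: circle_norm_rep.
apply: measurable_minr; first exact: measurable_circle_rep.
by apply: measurable_funB => //; exact: measurable_circle_rep.
Qed.

Lemma measurable_circleB d (X : measurableType d) (f g : X -> circle) :
  measurable_fun setT f -> measurable_fun setT g ->
  measurable_fun setT (fun x => f x - g x).
Proof.
move=> mf mg.
rewrite (_ : (fun x => _) =
    to_circle \o (fun x => circle_rep (f x) - circle_rep (g x))).
  apply: measurableT_comp; first exact: measurable_to_circle.
  by apply: measurable_funB; apply: measurableT_comp => //;
    exact: measurable_circle_rep.
by apply/funext => x /=; rewrite to_circleB !to_circle_rep.
Qed.

End circle.

(* Lebesgue measure on [0, 1], as a measure on R: functions on [0, 1] are
   represented by functions on R whose values outside [0, 1] are irrelevant. *)
Definition lebesgue01 (R : realType) : set (measurableTypeR R) -> \bar R :=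
  mrestr (@lebesgue_measure R) (measurable_itv `[0, 1]).
HB.instance Definition _ (R : realType) := Measure.on (@lebesgue01 R).

Lemma lebesgue01_setT (R : realType) : @lebesgue01 R setT = 1%E.
Proof.
by rewrite /lebesgue01 /mrestr setTI lebesgue_measure_itv/= lte01 oppr0 adde0.
Qed.

HB.instance Definition _ (R : realType) :=
  Measure_isProbability.Build _ _ R (@lebesgue01 R) (@lebesgue01_setT R).

Arguments lebesgue01 {R}.

Section Theta.
Variable R : realType.
Notation mu := (@lebesgue01 R).

(* An element of Theta is an almost-everywhere class; the coercion to functions
   below picks a representative, on which no definition depends. *)
Definition Theta : Type := {mfun_ mu, measurableTypeR R >-> circle R}.
HB.instance Definition _ := Choice.on Theta.

Definition Theta_to_fun (theta : Theta) : measurableTypeR R -> circle R :=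
  repr theta.
Coercion Theta_to_fun : Theta >-> Funclass.

Lemma Theta_eqP (theta phi : Theta) :
  theta = phi <-> {ae mu, forall x, theta x = phi x}.
Proof.
split=> [->|tp]; first exact: aeW.
rewrite -[theta]reprK -[phi]reprK; apply/eqquotP/asboolP.
by apply: filterS tp => x + _.
Qed.

Lemma measurable_Theta (theta : Theta) : measurable_fun setT theta.
Proof. exact: measurable_funPT. Qed.

Definition d_Theta (theta phi : Theta) : R :=
  Num.sqrt (\int[mu]_x (circle_norm (theta x - phi x) ^+ 2)).

Let dist (theta phi : Theta) (x : measurableTypeR R) :=
  circle_norm (theta x - phi x).

Let measurable_dist theta phi : measurable_fun setT (dist theta phi).
Proof.
apply: measurableT_comp; first exact: measurable_circle_norm.
by apply: measurable_circleB; exact: measurable_Theta.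
Qed.

Let sqrt_Rintegral (f : measurableTypeR R -> R) :
  Num.sqrt (\int[mu]_x f x ^+ 2) = fine ('N[mu]_2%:E[EFin \o f])%E.
Proof.
rewrite Lnorm.unlock /Rintegral fine_poweR powR12_sqrt; last first.
  by apply/fine_ge0/integral_ge0 => x _; exact: poweR_ge0.
congr (Num.sqrt (fine _)); apply: eq_integral => x _.
by rewrite poweR_EFin powR_mulrn// real_normK// num_real.
Qed.

Let Lnorm_dist_fin theta phi :
  ('N[mu]_2%:E[EFin \o dist theta phi] \is a fin_num)%E.
Proof.
rewrite ge0_fin_numE ?Lnorm_ge0// Lnorm.unlock poweR_lty//.
apply: (@le_lt_trans _ _ (\int[mu]_x (cst ((pi *+ 2) `^ 2)%:E x))%E).
  apply: ge0_le_integral => //.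
  - by move=> x _; exact: poweR_ge0.
  - apply/measurable_EFinP/(measurableT_comp (@measurable_powR R 2)).
    by apply: measurableT_comp.
  - move=> x _; rewrite /= lee_fin ge0_ler_powR// ?nnegrE//.
      by rewrite mulrn_wge0// pi_ge0.
    by rewrite ger0_norm ?circle_norm_ge0// circle_norm_le.
by rewrite integral_cst//= lebesgue01_setT mule1 ltry.
Qed.

Let d_ThetaE theta phi :
  d_Theta theta phi = fine ('N[mu]_2%:E[EFin \o dist theta phi])%E.
Proof. exact: sqrt_Rintegral. Qed.

Lemma d_Thetaxx theta : d_Theta theta theta = 0.
Proof.
rewrite /d_Theta (_ : (\int[mu]_x _) = 0) ?sqrtr0// /Rintegral.
by rewrite integral0_eq// => x _; rewrite subrr circle_norm0 expr0n.
Qed.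

Lemma d_Theta_eq0 theta phi : d_Theta theta phi = 0 -> theta = phi.
Proof.
rewrite d_ThetaE => d0; have {d0} : ('N[mu]_2%:E[EFin \o dist theta phi] = 0)%E.
  by rewrite -[LHS]fineK ?d0//; exact: Lnorm_dist_fin.
move=> /Lnorm_eq0_eq0 d0; apply/Theta_eqP.
have : ae_eq mu setT (EFin \o dist theta phi) (cst 0%E).
  by apply: d0 => //; apply/measurable_EFinP; exact: measurable_dist.
apply: filterS => x /(_ I) [] /circle_norm_eq0/eqP.
by rewrite subr_eq0 => /eqP.
Qed.

Lemma d_Theta_sym theta phi : d_Theta theta phi = d_Theta phi theta.
Proof.
rewrite /d_Theta; congr Num.sqrt; apply: eq_Rintegral => x _.
by rewrite -circle_normN opprB.
Qed.

Lemma d_Theta_triangle psi theta phi :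
  d_Theta theta phi <= d_Theta theta psi + d_Theta psi phi.
Proof.
rewrite !d_ThetaE -lee_fin [leRHS]EFinD !fineK; [|exact: Lnorm_dist_fin..].
have mD : measurable_fun setT (dist theta psi \+ dist psi phi).
  by apply: measurable_funD; exact: measurable_dist.
apply: (@le_trans _ _
    'N[mu]_2%:E[EFin \o (dist theta psi \+ dist psi phi)%R]%E);
  last by apply: minkowski_EFin; rewrite ?ler1n//; exact: measurable_dist.
rewrite Lnorm.unlock; apply: gt0_ler_poweR => //.
- by rewrite in_itv/= leey integral_ge0// => x _; exact: poweR_ge0.
- by rewrite in_itv/= leey integral_ge0// => x _; exact: poweR_ge0.
apply: ge0_le_integral => //.
- by move=> x _; exact: poweR_ge0.
- apply/measurable_EFinP/(measurableT_comp (@measurable_powR R 2)).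
  by apply: measurableT_comp => //; exact: measurable_dist.
- apply/measurable_EFinP/(measurableT_comp (@measurable_powR R 2)).
  exact: measurableT_comp.
move=> x _; rewrite /= lee_fin ge0_ler_powR// ?nnegrE//.
rewrite !ger0_norm ?addr_ge0 ?circle_norm_ge0// /dist.
rewrite -[theta x - phi x](subrKA (psi x)).
exact: circle_normD.
Qed.

HB.instance Definition _ :=
  isMetric.Build R Theta d_Thetaxx d_Theta_eq0 d_Theta_sym d_Theta_triangle.

End Theta.

Section dynamics.
Variable R : realType.
Notation mu := (@lebesgue01 R).
Implicit Types (K Ks : R) (theta : Theta R).

Definition velocity K Ks theta (phi : circle R) : R :=
  K * (\int[mu]_y circle_sin (phi - theta y)) - Ks * circle_sin (phi *+ 2).

Definition energy K Ks theta : R :=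
  K / 2 * (\int[mu]_x \int[mu]_y circle_cos (theta x - theta y))
  - Ks / 2 * (\int[mu]_x circle_cos (theta x *+ 2)).

Definition fixed_points K Ks : set (Theta R) :=
  [set theta | {ae mu, forall x, velocity K Ks theta (theta x) = 0}].

(* LfunType is not quotiented: its elements are representatives of the classes
   of L^2([0, 1]), and L2_norm is a seminorm on it. *)
Definition L2 := LfunType mu (lee1n 2).

Definition L2_norm (f : L2) : R := fine 'N[mu]_2%:E[EFin \o f].

(* u' is the L^2-derivative of u on [0, +oo[, one-sided at 0, and is
   L^2-continuous. *)
Definition C1_L2 (u u' : R -> L2) : Prop :=
  (forall t : R, 0 <= t ->
    L2_norm (h^-1 *: (u (t + h) - u t) - u' t)
      @[h --> within [set h | 0 <= t + h] 0^'] --> 0) /\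
  (forall t : R, 0 <= t ->
    L2_norm (u' s - u' t) @[s --> within `[0, +oo[ (nbhs t)] --> 0).

Definition trajectory K Ks (theta : R -> Theta R) : Prop :=
  exists (theta0 : Theta R) (u u' : R -> L2),
    [/\ {ae mu, forall x, u 0 x = 0},
        C1_L2 u u',
        forall t : R, 0 <= t ->
          {ae mu, forall x, theta t x = theta0 x + to_circle (u t x)} &
        forall t : R, 0 <= t ->
          {ae mu, forall x, u' t x = velocity K Ks (theta t) (theta t x)}].

Definition accumulation_points (theta : R -> Theta R) : set (Theta R) :=
  [set theta_star | exists t : nat -> R,
    [/\ forall n, 0 <= t n, t n @[n --> \oo] --> +oo &
        theta (t n) @[n --> \oo] --> theta_star]].

End dynamics.

(* Main.v *)
(* Points that start at the same angle move together and the velocity field is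
   Lipschitz, so theta(t) is the composition of a monotone degree-one map of the
   circle with theta_0. Compositions with a fixed function of monotone maps with
   values in a bounded interval form a compact subset of Theta (a Helly-type
   argument), hence the trajectory is precompact and its limit set is nonempty,
   compact and connected. The flow is the gradient flow of the energy: E decreases
   at the rate ||v||^2, so it converges along the trajectory, and since ||v|| is
   Lipschitz along the trajectory it vanishes at accumulation points.

   Time derivatives enter only through upper right Dini estimates. The monotone
   form of theta(t) is obtained without solving the characteristic equation: an
   explicit Euler step preserves the class of monotone maps, so the L^2 distance
   of theta(t) to this class satisfies a Gronwall inequality and stays zero. *)

Require Import Defs.
From mathcomp Require Import all_boot all_order all_algebra.
From mathcomp Require Import all_classical all_reals all_analysis.
From mathcomp Require Import measurable_realfun lra ring.

Set Implicit Arguments.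
Unset Strict Implicit.
Unset Printing Implicit Defensive.

Import Order.TTheory GRing.Theory Num.Theory.
Import numFieldNormedType.Exports.

Local Open Scope classical_set_scope.
Local Open Scope ring_scope.

(** * Dini derivatives *)

(** The equation is an identity in [L^2]: at each time it holds off a null set that depends on the
    time, so no single label x is known to follow an ODE. Every argument therefore runs through a
    scalar function of time (a norm, the distance to a set, the energy), for which increments to the
    right are enough; a distance defined as an infimum need not be differentiable anyway. Theta is
    bounded but not compact, and a bound on the energy gives no compactness. What does is that the
    lift of [theta_0] to [0, 2 pi[ stays the same at all times, while only the monotone map applied
    to it moves. The law of this lift is arbitrary and may have atoms, so monotone maps are compared
    on a grid of quantiles, on which the large atoms lie. Compactness is taken for pointwise
    convergence, by Tychonoff, rather than by selecting subsequences. *)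

Lemma dini_le (R : realType) (f : R -> R) (a b c : R) : a <= b ->
  (forall t e, a <= t <= b -> 0 < e -> exists2 d, 0 < d &
     forall s, a <= s <= b -> `|t - s| < d -> `|f t - f s| <= e) ->
  (forall t e, a <= t < b -> 0 < e -> exists2 d, 0 < d &
     forall h, 0 < h < d -> t + h <= b -> f (t + h) <= f t + h * (c + e)) ->
  f b <= f a + c * (b - a).
Proof.
move=> ab cf fD.
suff H e : 0 < e -> f b <= f a + (c + e) * (b - a).
  have [<-|anb] := eqVneq a b; first lra.
  have ltab : 0 < b - a by rewrite subr_gt0 lt_neqAle anb.
  apply/ler_addgt0Pr => e e0; have /H : 0 < e / (b - a) by exact: divr_gt0.
  rewrite (mulrDl c) mulfVK ?gt_eqF//; lra.
move=> e0; rewrite leNgt; apply/negP => fab.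
pose g t := f t - (c + e) * (t - a).
(* Times are tested one by one, so [S] need not be an interval. Its supremum belongs to it by
   continuity, and the increment bound, with slack [e], leads from any point of [S] before [b] to a
   later one; but [fab] keeps [b] out of [S]. *)
pose S := [set t | a <= t <= b /\ g t <= g a].
have Sa : S a by split; [apply/andP|].
have supS : has_sup S by split; [exists a|exists b => t [/andP[]]].
pose T := sup S.
have Tab : a <= T <= b.
  apply/andP; split; first exact: ub_le_sup supS.2 _ Sa.
  by apply: ge_sup; [exists a|move=> t [/andP[]]].
have gT : g T <= g a.
  apply/ler_addgt0Pr => d d0.
  have [d1 d10 fd1] := cf T (d / 2) Tab ltac:(by rewrite divr_gt0).
  pose M := `|c + e| + 1.
  have M0 : 0 < M by rewrite /M addrC ltr_pwDl.
  pose d2 := Num.min d1 (d / 2 / M).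
  have d20 : 0 < d2 by rewrite lt_min d10 !divr_gt0.
  have [t St tT] := sup_adherent d20 supS.
  have tT' : t <= T by exact: ub_le_sup supS.2 _ St.
  have Ttd2 : T - t < d2 by move: tT; rewrite -/T; lra.
  have := fd1 t St.1; rewrite ger0_norm ?subr_ge0//.
  have d21 : d2 <= d1 by rewrite ge_min lexx.
  have d22 : d2 <= d / 2 / M by rewrite ge_min lexx orbT.
  move=> /(_ (lt_le_trans Ttd2 d21)); have := ler_norm (f T - f t).
  have : - (c + e) * (T - t) <= d / 2.
    have := le_trans (ltW Ttd2) d22; rewrite ler_pdivlMr// mulrC.
    apply: le_trans; rewrite ler_wpM2r ?subr_ge0// /M -normrN.
    by rewrite (le_trans (ler_norm _))// lerDl.
  by have := St.2; rewrite /g; lra.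
have Tb : T < b.
  rewrite lt_neqAle (andP Tab).2 andbT; apply/eqP => Tb.
  by move: gT; rewrite Tb /g subrr mulr0; lra.
have [d d0 fd] := fD T e ltac:(by rewrite (andP Tab).1) e0.
pose h := Num.min (d / 2) (b - T).
have h0 : 0 < h by rewrite lt_min divr_gt0//= subr_gt0.
have hd : h <= d / 2 by rewrite ge_min lexx.
have hb : h <= b - T by rewrite ge_min lexx orbT.
have := fd h ltac:(rewrite h0/=; lra) ltac:(lra).
move=> fTh; have STh : S (T + h).
  split; first by move/andP: Tab => [? ?]; lra.
  by move: gT; rewrite /g; lra.
have := ub_le_sup supS.2 STh; rewrite -/T; lra.
Qed.

Lemma gronwall0 (R : realType) (f : R -> R) (L V : R) : 0 < L ->
  (forall t, 0 <= t -> 0 <= f t) -> f 0 = 0 ->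
  (forall t s, 0 <= t -> 0 <= s -> `|f t - f s| <= V * `|t - s|) ->
  (forall t e, 0 <= t -> 0 < e -> exists2 d, 0 < d &
    forall h, 0 < h < d -> f (t + h) <= f t + h * (L * f t + e)) ->
  forall t, 0 <= t -> f t = 0.
Proof.
move=> L0 f0 f00 fV fD.
have V0 : 0 <= V.
  have := fV 0 1 (lexx _) ler01; rewrite sub0r normrN normr1 mulr1.
  exact: le_trans.
pose tau := (2 * L)^-1.
have tau0 : 0 < tau by rewrite invr_gt0 mulr_gt0.
have step a b : 0 <= a -> f a = 0 -> a <= b -> b <= a + tau -> f b = 0.
  move=> a0 fa ab bt.
  pose S := [set f s | s in [set s | a <= s <= a + tau]].
  have Sa : S 0 by exists a => //=; rewrite lexx lerDl ltW.
  have SV : ubound S (V * tau).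
    move=> _ [s /= /andP[as' st] <-].
    have := fV s a (le_trans a0 as') a0; rewrite fa subr0 => h.
    apply: le_trans (ler_norm _) _; apply: le_trans h _.
    by rewrite ler_wpM2l// ger0_norm ?subr_ge0// lerBlDl.
  have supS : has_sup S by split; [exists 0|exists (V * tau)].
  have S0 : 0 <= sup S by exact: ub_le_sup supS.2 _ Sa.
  have fS s : a <= s <= a + tau -> f s <= sup S.
    by move=> ast; apply: ub_le_sup supS.2 _ _; exists s.
  have half s : a <= s <= a + tau -> f s <= sup S / 2.
    move=> /andP[as' st].
    have := @dini_le R f a s (L * sup S) as' _ _.
    rewrite fa add0r => H; apply: le_trans (H _ _) _.
    - move=> t e /andP[at' _] e0; exists (e / (V + 1)).
        by rewrite divr_gt0// ltr_wpDl.
      move=> s' /andP[as2 _]; rewrite ltr_pdivlMr ?ltr_wpDl// => ts.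
      apply: le_trans (fV t s' (le_trans a0 at') (le_trans a0 as2)) _.
      by apply: le_trans (ltW ts); rewrite mulrC ler_wpM2l// lerDl.
    - move=> t e /andP[at' ts] e0.
      have [d d0 fd] := fD t e (le_trans a0 at') e0; exists d => // h hd _.
      apply: le_trans (fd h hd) _; have /andP[h0 _] := hd.
      rewrite lerD2l ler_wpM2l ?(ltW h0)// lerD2r ler_wpM2l ?(ltW L0)//.
      by apply: fS; rewrite at' (le_trans (ltW ts)).
    have -> : sup S / 2 = L * sup S * tau.
      by rewrite /tau; field; rewrite gt_eqF.
    by rewrite ler_wpM2l ?mulr_ge0 ?(ltW L0)// lerBlDl.
  have : sup S <= sup S / 2.
    by apply: ge_sup => [|_ [s /= sa <-]]; [exists 0|exact: half].
  move=> SS; apply/eqP; rewrite eq_le f0 ?(le_trans a0)// andbT.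
  by apply: le_trans (fS b _) _; [rewrite ab|lra].
have fn (n : nat) : f (n%:R * tau) = 0.
  elim: n => [|n IH]; first by rewrite mul0r.
  apply: (step (n%:R * tau)) => //.
  - by rewrite mulr_ge0// ltW.
  - by rewrite ler_wpM2r ?(ltW tau0)// ler_nat.
  - by rewrite -natr1 mulrDl mul1r.
move=> t t0; pose n := Num.truncn (t / tau).
have tn : n%:R <= t / tau by rewrite truncn_le divr_ge0// ltW.
apply: (step (n%:R * tau)) => //.
- by rewrite mulr_ge0// ltW.
- by rewrite -ler_pdivlMr.
- have := truncnS_gt (t / tau); rewrite -/n ltr_pdivrMr// => /ltW.
  by rewrite -natr1 mulrDl mul1r.
Qed.

(** * The space L^2 of a probability measure *)

Section norm2.
Context d (T : measurableType d) (R : realType) (P : probability T R).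
Implicit Types f g : T -> R.

Notation L2 := (Lfun P 2%:E).

(** [L2_norm] on bare functions and for any probability. As [fine] sends [+oo] to 0, most estimates
    carry membership in [L2] as a hypothesis. *)
Definition norm2 f : R := fine 'N[P]_2%:E[EFin \o f]%E.

Lemma norm2_ge0 f : 0 <= norm2 f.
Proof. exact/fine_ge0/Lnorm_ge0. Qed.

Lemma Lfun2_measurable f : f \in L2 -> measurable_fun setT f.
Proof. by move=> /andP[/set_mem]. Qed.

Lemma Lfun2_fin f : f \in L2 -> ('N[P]_2%:E[EFin \o f] \is a fin_num)%E.
Proof.
by move=> /andP[_ /set_mem]; rewrite ge0_fin_numE// Lnorm_ge0.
Qed.

Lemma Lfun2D f g : f \in L2 -> g \in L2 -> f \+ g \in L2.
Proof. exact: (Lfun_addr_closed P (lee1n 2)).2. Qed.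

Lemma Lfun2Z (a : R) f : f \in L2 -> a \*: f \in L2.
Proof.
move=> lf; have [L20 L2Z] := Lfun_submod_closed P (lee1n 2).
by have := L2Z a f 0 lf L20; rewrite addr0.
Qed.

Lemma Lfun2N f : f \in L2 -> \- f \in L2.
Proof. exact: Lfun_oppr_closed. Qed.

Lemma Lfun2B f g : f \in L2 -> g \in L2 -> f \- g \in L2.
Proof. by move=> lf lg; exact/Lfun2D/Lfun2N. Qed.

Lemma norm2D f g : f \in L2 -> g \in L2 -> norm2 (f \+ g) <= norm2 f + norm2 g.
Proof.
move=> lf lg; have lfg : f \+ g \in L2 by exact: Lfun2D.
rewrite -lee_fin EFinD !fineK ?Lfun2_fin//.
by apply: minkowski_EFin; [exact: Lfun2_measurable..|rewrite ler1n].
Qed.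

Lemma norm2Z (a : R) f : f \in L2 -> norm2 (a \*: f) = `|a| * norm2 f.
Proof.
move=> lf; have -> : f = Lfun_Sub (lee1n 2) lf by [].
by rewrite /norm2 LnormZ fineM// Lfun2_fin.
Qed.

Lemma norm2N f : norm2 (\- f) = norm2 f.
Proof. exact: congr1 (oppe_Lnorm P (EFin \o f) 2%:E). Qed.

Lemma int_sqr f : f \in L2 -> \int[P]_x (f x ^+ 2) = norm2 f ^+ 2.
Proof.
move=> lf; rewrite -powR_mulrn ?norm2_ge0// -fine_poweR poweR_Lnorm//.
congr fine; apply: eq_integral => x _ /=.
by rewrite powR_mulrn// real_normK// num_real.
Qed.

Lemma bounded_Lfun2 f (c : R) : measurable_fun setT f ->
  (forall x, `|f x| <= c) -> f \in L2.
Proof.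
move=> mf fc; rewrite inE; apply/andP; split; rewrite inE//=.
rewrite /finite_norm Lnorm.unlock poweR_lty//.
apply: (@le_lt_trans _ _ (\int[P]_x (cst (c ^+ 2)%:E x))%E); last first.
  by rewrite integral_cst//= probability_setT mule1 ltry.
apply: ge0_le_integral => //.
- by move=> x _; exact: poweR_ge0.
- apply/measurable_EFinP/(measurableT_comp (@measurable_powR R 2)).
  exact: measurableT_comp.
- by move=> x _; rewrite /= lee_fin powR_mulrn// lerXn2r// nnegrE (le_trans _ (fc x)).
Qed.

Lemma le_norm2 f g : f \in L2 -> g \in L2 ->
  {ae P, forall x, `|f x| <= `|g x|} -> norm2 f <= norm2 g.
Proof.
move=> lf lg fg; rewrite /norm2 fine_le ?Lfun2_fin//.
rewrite Lnorm.unlock; apply: gt0_ler_poweR => //.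
- by rewrite in_itv/= leey integral_ge0// => x _; exact: poweR_ge0.
- by rewrite in_itv/= leey integral_ge0// => x _; exact: poweR_ge0.
have mp h : h \in L2 -> measurable_fun setT (fun x => (`|(EFin \o h) x| `^ 2)%E).
  move=> lh; apply/measurable_EFinP/(measurableT_comp (@measurable_powR R 2)).
  exact/measurableT_comp/Lfun2_measurable.
apply: ae_ge0_le_integral => //.
- by move=> x _; exact: poweR_ge0.
- exact: mp.
- by move=> x _; exact: poweR_ge0.
- exact: mp.
by apply: filterS fg => x fgx _; rewrite /= lee_fin ge0_ler_powR// ?nnegrE.
Qed.

Lemma norm2_cst (c : R) : norm2 (cst c) = `|c|.
Proof.
have lc : cst c \in L2 by exact: Lfun_cst.
apply/eqP; rewrite -(@eqrXn2 _ 2) ?norm2_ge0// -int_sqr//.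
have /= -> := Rintegral_cst P measurableT (c ^+ 2).
by rewrite [X in fine X]probability_setT mulr1 real_normK// num_real.
Qed.

Lemma norm2_le f (c : R) : f \in L2 -> 0 <= c ->
  {ae P, forall x, `|f x| <= c} -> norm2 f <= c.
Proof.
move=> lf c0 fc; rewrite -[leRHS]ger0_norm// -norm2_cst.
apply: le_norm2 => //; first exact: Lfun_cst.
by apply: filterS fc => x /= /le_trans; apply; rewrite ger0_norm.
Qed.

Lemma Lfun2_integrable f : f \in L2 -> P.-integrable setT (EFin \o f).
Proof.
move=> lf; apply/Lfun1_integrable; apply: Lfun_subset12 => //.
exact: fin_num_measure.
Qed.

Lemma mul_Lfun2_integrable f g : f \in L2 -> g \in L2 ->
  P.-integrable setT (EFin \o (fun x => f x * g x)).
Proof. by move=> lf lg; apply/Lfun1_integrable/Lfun2_mul_Lfun1. Qed.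

Lemma norm_int_mul f g : f \in L2 -> g \in L2 ->
  `|\int[P]_x (f x * g x)| <= norm2 f * norm2 g.
Proof.
move=> lf lg; apply: le_trans (le_normr_Rintegral _ (mul_Lfun2_integrable lf lg)) _ => //.
rewrite -lee_fin EFinM !fineK ?Lfun2_fin//; last first.
  have /(integrable_norm)/integrable_fin_num := mul_Lfun2_integrable lf lg.
  exact.
have := hoelder P (Lfun2_measurable lf) (Lfun2_measurable lg) (ltr0n _ 2) (ltr0n _ 2).
by rewrite Lnorm1; apply; lra.
Qed.

(** Cauchy-Schwarz against the constant 1, which has norm 1 for a probability. *)
Lemma norm_int_le f : f \in L2 -> `|\int[P]_x f x| <= norm2 f.
Proof.
move=> lf; have := norm_int_mul lf (Lfun_cst P 1 2).
by rewrite norm2_cst normr1 mulr1; under eq_Rintegral do rewrite /= mulr1.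
Qed.

Lemma norm2_eq0 f : f \in L2 -> norm2 f = 0 -> {ae P, forall x, f x = 0}.
Proof.
move=> lf f0; have : ('N[P]_2%:E[EFin \o f] = 0)%E.
  by rewrite -(fineK (Lfun2_fin lf)) -/(norm2 f) f0.
have mf : measurable_fun setT (EFin \o f).
  exact/measurable_EFinP/Lfun2_measurable.
have two_gt0 : (0 < 2%:E :> \bar R)%E by rewrite lte_fin.
by move=> /(Lnorm_eq0_eq0 mf two_gt0); apply: filterS => x /(_ I) [].
Qed.

(** Integrates a pointwise expansion to first order in [k], the quadratic remainder becoming a
    squared norm. It expands the trigonometric moments in [energy_taylor]. *)
Lemma int_remainder (f g h k : T -> R) (c : R) :
  f \in L2 -> g \in L2 -> h \in L2 -> k \in L2 -> 0 <= c ->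
  {ae P, forall x, `|f x - (g x + k x * h x)| <= c * k x ^+ 2} ->
  `|\int[P]_x f x - (\int[P]_x g x + \int[P]_x (k x * h x))| <=
    c * norm2 k ^+ 2.
Proof.
move=> lf lg lh lk c0 H.
have ig := Lfun2_integrable lg; have iff := Lfun2_integrable lf.
have ikh := mul_Lfun2_integrable lk lh.
have igkh : P.-integrable setT (EFin \o (fun x => g x + k x * h x)).
  rewrite (_ : _ \o _ = (fun x => (g x)%:E + (k x * h x)%:E)%E)//.
  by apply: integrableD.
have iB : P.-integrable setT (EFin \o (fun x => f x - (g x + k x * h x))).
  rewrite (_ : _ \o _ = (fun x => (f x)%:E - (g x + k x * h x)%:E)%E)//.
  by apply: integrableB.
rewrite -RintegralD// -RintegralB//.
apply: le_trans (le_normr_Rintegral _ iB) _ => //.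
rewrite -int_sqr// -RintegralZl//; last exact: Lfun2_integrable_sqr.
have ik := Lfun2_integrable_sqr lk.
have ick : P.-integrable setT (EFin \o (fun x => c * k x ^+ 2)).
  rewrite (_ : _ \o _ = (fun x => c%:E * (k x ^+ 2)%:E)%E)//.
  by apply: integrableZl.
have inB := integrable_norm iB.
apply: fine_le; [exact: integrable_fin_num inB|exact: integrable_fin_num ick|].
apply: ae_ge0_le_integral => //.
- exact: measurable_int inB.
- by move=> x _; rewrite lee_fin mulr_ge0// sqr_ge0.
- exact: measurable_int ick.
by apply: filterS H => x Hx _; rewrite lee_fin.
Qed.

End norm2.

(** * Limit sets of precompact curves *)

Section omega_limit.
Context {R : realType} {T : metricType R}.
Variables (x : R -> T) (K : set T).
Hypothesis cK : compact K.
Hypothesis xK : forall t : R, 0 <= t -> K (x t).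
Hypothesis cx : forall t e : R, 0 <= t -> 0 < e -> exists2 d, 0 < d &
  forall s : R, 0 <= s -> `|t - s| < d -> mdist (x t) (x s) < e.

(** Convertible to [accumulation_points], so the results of this section apply to trajectories as
    they stand. *)
Definition omega_limit : set T := [set p | exists t : nat -> R,
  [/\ forall n, 0 <= t n, t n @[n --> \oo] --> +oo & x (t n) @[n --> \oo] --> p]].

Lemma omega_limitP p : omega_limit p <->
  forall M e : R, 0 < e -> exists2 t : R, 0 <= t /\ M <= t & mdist p (x t) < e.
Proof.
split=> [[t [t0 toc xtp]] M e e0|H].
  have /metricType_numDomainType.cvgrPdist_lt/(_ e e0)/= near_p := xtp.
  have /cvgryPge/(_ M) near_M := toc.
  have [n [Mn pn]] := filter_ex (filterI near_M near_p).
  by exists (t n).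
have /choice[t tP] : forall n : nat, exists t,
    (0 <= t /\ n%:R <= t) /\ mdist p (x t) < n.+1%:R^-1.
  move=> n; have [|t nt pt] := H n%:R (n.+1%:R^-1); first by rewrite invr_gt0.
  by exists t.
exists t; split=> [n||]; first exact: (tP n).1.1.
  apply/cvgryPge => A; near=> n; apply: le_trans (tP n).1.2.
  by near: n; exact: nbhs_infty_ger.
apply/metricType_numDomainType.cvgrPdist_lt => e e0; near=> n.
apply: lt_trans (tP n).2 _; near: n.
exact: (near_infty_natSinv_lt (PosNum e0)).
Unshelve. all: by end_near. Qed.

Lemma omega_limit_sub : omega_limit `<=` K.
Proof.
move=> p /omega_limitP H; have := compact_closed (@metric_hausdorff _ T) cK.
apply => B /(iffLR (metricType_numDomainType.nbhs_mdistP p B))[e /= e0 eB].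
have [t [t0 _] pt] := H 0 e e0.
by exists (x t); split; [exact: xK|exact: eB].
Qed.

(** Stands in for the extraction of a convergent subsequence: a cluster point already meets the
    criterion of [omega_limitP]. *)
Lemma cluster_seq_omega_limit (t : nat -> R) p :
  (forall n, 0 <= t n) -> (forall n, n%:R <= t n) ->
  cluster (x (t n) @[n --> \oo]) p -> omega_limit p.
Proof.
move=> t0 tn clp; apply/omega_limitP => M e e0.
have near_M : \forall n \near \oo, ((x \o t) @` [set n | M <= n%:R]) (x (t n)).
  by near=> n; exists n => //=; near: n; exact: nbhs_infty_ger.
have pe : nbhs p [set y | mdist p y < e].
  by apply/metricType_numDomainType.nbhs_mdistP; exists e.
have [_ [[n /= Mn <-] pn]] := clp _ _ near_M pe.
by exists (t n) => //; split => //; exact: le_trans (tn n).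
Unshelve. all: by end_near. Qed.

Lemma cluster_seq (t : nat -> R) : (forall n, 0 <= t n) ->
  exists2 p, K p & cluster (x (t n) @[n --> \oo]) p.
Proof.
move=> t0; have FK : (x (t n) @[n --> \oo]) K by exists 0 => // n _; exact: xK.
by have [p [Kp clp]] := cK _ FK; exists p.
Qed.

Lemma omega_limit_neq0 : omega_limit !=set0.
Proof.
have [p _ clp] := cluster_seq (fun n => ler0n R n).
by exists p; exact: cluster_seq_omega_limit clp.
Qed.

Lemma omega_limit_closed : closed omega_limit.
Proof.
move=> p clp; apply/omega_limitP => M e e0.
have e20 : 0 < e / 2 by rewrite divr_gt0.
have /clp[q [/omega_limitP H pq]] : nbhs p [set y | mdist p y < e / 2].
  by apply/metricType_numDomainType.nbhs_mdistP; exists (e / 2).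
have [t Mt qt] := H M _ e20; exists t => //.
by apply: le_lt_trans (metric_triangle p q (x t)) _; rewrite (splitr e) ltrD.
Qed.

Lemma omega_limit_compact : compact omega_limit.
Proof. exact: subclosed_compact omega_limit_closed cK omega_limit_sub. Qed.

Let dist_to (A : set T) y := inf [set mdist p y | p in A].

Let dist_to_le A y p : A p -> dist_to A y <= mdist p y.
Proof.
by move=> Ap; apply: ge_inf; [exists 0 => _ [q _ <-]; exact: mdist_ge0|exists p].
Qed.

Let dist_to_ge0 A y : A !=set0 -> 0 <= dist_to A y.
Proof.
move=> [p Ap]; apply: lb_le_inf; first by exists (mdist p y), p.
by move=> _ [q _ <-]; exact: mdist_ge0.
Qed.

Let dist_to_lip A y z : A !=set0 -> dist_to A y <= dist_to A z + mdist z y.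
Proof.
move=> A0; rewrite -lerBlDr; apply: lb_le_inf.
  by have [p Ap] := A0; exists (mdist p z), p.
move=> _ [q Aq <-]; rewrite lerBlDr.
by apply: le_trans (metric_triangle q z y); exact: dist_to_le.
Qed.

Let dist_to_gt0 A y : A !=set0 -> closed A -> ~ A y -> 0 < dist_to A y.
Proof.
move=> A0 cA nAy; rewrite lt_neqAle dist_to_ge0// andbT; apply/eqP => d0.
apply: nAy; apply: cA => B /(iffLR (metricType_numDomainType.nbhs_mdistP y B))[e /= e0 eB].
have [_ [q Aq <-]] : exists2 r, [set mdist p y | p in A] r & r < e.
  have hi : has_inf [set mdist p y | p in A].
    split; first by have [p Ap] := A0; exists (mdist p y), p.
    by exists 0 => _ [q _ <-]; exact: mdist_ge0.
  have [r Ar] := inf_adherent e0 hi.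
  by rewrite -/(dist_to A y) -d0 add0r => ?; exists r.
by move=> qe; exists q; split => //; apply: eB; rewrite /= metric_sym.
Qed.

(* The difference of the distances to two separated pieces of the limit set
   changes sign along the trajectory at arbitrarily large times; its zeros
   accumulate at a point of neither piece. *)
Lemma omega_limit_connected : connected omega_limit.
Proof.
apply: contrapT => /connectedPn[E [E0 EU [sep1 sep2]]].
have sub b : E b `<=` omega_limit by rewrite EU; case: b; [right|left].
(* The pieces are closed in the whole space: the limit set is closed, and no limit of one piece lies
   in the other. *)
have cE b : closed (E b).
  move=> p clp; have : omega_limit p.
    by apply: omega_limit_closed; exact: closure_subset (sub b) _ clp.
  rewrite EU; case: b clp => clp [] // Ep.
    by have : (E false `&` closure (E true)) p by []; rewrite sep2.
  by have : (closure (E false) `&` E true) p by []; rewrite sep1.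
have dj p b : E b p -> ~ E (~~ b) p.
  move=> Ep Ep'; have : (closure (E false) `&` E true) p.
    by case: b Ep Ep' => Ep Ep'; split => //; exact: subset_closure.
  by rewrite sep1.
pose phi y := dist_to (E false) y - dist_to (E true) y.
have phi_lip y z : `|phi y - phi z| <= 2 * mdist y z.
  have := dist_to_lip y z (E0 false); have := dist_to_lip z y (E0 false).
  have := dist_to_lip y z (E0 true); have := dist_to_lip z y (E0 true).
  by rewrite (metric_sym z y) /phi ler_norml; lra.
have phiE b p : E b p -> if b then 0 < phi p else phi p < 0.
  move=> Ep; have := dist_to_gt0 (E0 (~~ b)) (cE (~~ b)) (dj _ _ Ep).
  have : dist_to (E b) p = 0.
    apply/eqP; rewrite eq_le dist_to_ge0// andbT.
    by rewrite -(mdistxx p); exact: dist_to_le.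
  by case: b {Ep} => /=; rewrite /phi => -> ?; lra.
have phi_t b M : exists2 t, 0 <= t /\ M <= t &
    if b then 0 < phi (x t) else phi (x t) < 0.
  have [p Ep] := E0 b; have /omega_limitP H := sub b _ Ep.
  have := phiE b p Ep; case: b Ep => Ep phip.
    have [|t tM pt] := H M (phi p / 2); first by rewrite divr_gt0.
    exists t => //; have := ler_norm (phi p - phi (x t)); have := phi_lip p (x t).
    lra.
  have [|t tM pt] := H M (- phi p / 2); first by rewrite divr_gt0// oppr_gt0.
  exists t => //; have := ler_norm (phi (x t) - phi p); have := phi_lip (x t) p.
  rewrite metric_sym; lra.
have zero (n : nat) : exists t, (0 <= t /\ n%:R <= t) /\ phi (x t) = 0.
  have [t1 [t10 nt1] phit1] := phi_t false n%:R.
  have [t2 [t20 t12] phit2] := phi_t true t1.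
  (* The absolute value extends the curve to negative times, which gives the intermediate value
     theorem a function continuous on the whole line. *)
  pose f (t : R) := phi (x `|t|).
  have cf : continuous f.
    move=> t; apply/cvgrPdist_lt => e e0.
    have [d d0 xd] := cx (normr_ge0 t) (divr_gt0 e0 (ltr0n R 2)).
    near=> s; apply: le_lt_trans (phi_lip _ _) _.
    rewrite mulrC -ltr_pdivlMr//; apply: xd => //.
    apply: le_lt_trans (ler_dist_dist _ _) _.
    by near: s; apply: cvgr_dist_lt.
  have [|t] := IVT t12 (continuous_subspaceT cf) (v := 0) _.
    rewrite /f !ger0_norm// /Num.min /Num.max.
    by rewrite (lt_trans phit1 phit2)/=; lra.
  rewrite in_itv/= /f => /andP[t1t _].
  rewrite ger0_norm ?(le_trans t10)// => phit; exists t; split => //; split.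
    exact: le_trans t1t.
  exact: le_trans t1t.
have /choice[t tP] := zero.
have [p Kp clp] := cluster_seq (fun n => (tP n).1.1).
have /[dup] Op : omega_limit p.
  exact: cluster_seq_omega_limit (fun n => (tP n).1.1) (fun n => (tP n).1.2) clp.
have phip : phi p = 0.
  apply/eqP; rewrite -normr_eq0 eq_le normr_ge0 andbT.
  apply/ler_addgt0Pr => e e0; rewrite add0r.
  have pe : nbhs p [set y | mdist p y < e / 2].
    by apply/metricType_numDomainType.nbhs_mdistP; exists (e / 2) => //=; rewrite divr_gt0.
  have near_t : \forall n \near \oo, range (x \o t) (x (t n)) by near=> n; exists n.
  have [_ [[n _ <-] /= pn]] := clp _ _ near_t pe.
  have := phi_lip p (x (t n)); rewrite (tP n).2 subr0; lra.
by rewrite EU => -[] /phiE; rewrite phip ltxx.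
Unshelve. all: by end_near. Qed.

End omega_limit.

(** * Compactness of monotone rearrangements *)

Section quantiles.
Context d (T : measurableType d) (R : realType) (P : probability T R).
Variables (r : T -> R) (B : R).
Hypothesis mr : measurable_fun setT r.
Hypothesis rB : forall x, 0 <= r x < B.

Lemma measurable_itv_preimage (i : interval R) :
  measurable [set x | r x \in i].
Proof.
by rewrite -[X in measurable X]setTI; exact: mr (measurable_itv i).
Qed.

(** The grid is the generalised inverse of the distribution function [H] at the multiples of [eta].
    Only open gaps can be required to have small mass: an atom heavier than [eta] must sit on a grid
    point, and grid points may coincide. *)
Lemma quantiles (eta : R) : 0 < eta -> exists (N : nat) (p : nat -> R),
  [/\ p 0 = 0, p N = B, {homo p : i j / (i <= j)%N >-> i <= j} &
    forall i, (P [set x | (p i < r x < p i.+1)%R] <= eta%:E)%E].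
Proof.
move=> eta0; pose H s := fine (P [set x | r x \in `]-oo, s[]).
have PH s : (P [set x | r x \in `]-oo, s[] = (H s)%:E)%E.
  by rewrite fineK// fin_num_measure//; exact: measurable_itv_preimage.
have H0 s : s <= 0 -> H s = 0.
  move=> s0; rewrite /H (_ : [set x | _] = set0) ?measure0//.
  apply/seteqP; split => // x /=; rewrite in_itv/= => rs.
  by have /andP[] := rB x; lra.
have H1 s : H s <= 1.
  by rewrite -lee_fin -PH probability_le1//; exact: measurable_itv_preimage.
have Hle s s' : s <= s' -> H s <= H s'.
  move=> ss'; rewrite -lee_fin -!PH le_measure ?inE//; last first.
    by move=> x /=; rewrite !in_itv/= => /lt_le_trans; apply.
  - exact: measurable_itv_preimage.
  - exact: measurable_itv_preimage.
have T0 : exists x : T, True.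
  apply: contrapT => nT; have : P setT = 0%E.
    by rewrite (_ : setT = set0) ?measure0//; apply/seteqP; split=> // x; case: nT; exists x.
  by rewrite probability_setT => /eqP; rewrite onee_eq0.
have B0 : 0 < B by have [x _] := T0; have /andP[] := rB x; exact: le_lt_trans.
(* The alternative [s <= 0] keeps [A i] nonempty for [i = 0] and gives [p 0 = 0]; the cap at [B]
   keeps it bounded. *)
pose A (i : nat) := [set s : R | s <= B /\ (s <= 0 \/ H s < i%:R * eta)].
have A0 i : A i 0 by split; [exact: ltW|left].
have supA i : has_sup (A i) by split; [exists 0|exists B => s []].
pose p i := sup (A i).
have p_ge0 i : 0 <= p i by exact: ub_le_sup (supA i).2 _ (A0 i).
have Hlt i s : s < p i -> H s <= i%:R * eta.
  move=> sp; have [s' As' ss'] := sup_gt (supA i).1 sp.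
  case: As' => _ [s'0|/ltW Hs'].
    by rewrite H0 ?mulr_ge0// ?ltW//; exact: lt_le_trans s'0.
  by apply: le_trans Hs'; apply/Hle/ltW.
have Hgt i s : p i < s -> s <= B -> i%:R * eta <= H s.
  move=> ps sB; rewrite leNgt; apply/negP => Hs.
  have /(ub_le_sup (supA i).2) : A i s by split => //; right.
  by rewrite -/(p i); lra.
(* This [N] satisfies [N * eta > 1], so that [H < N * eta] everywhere and [p N = B]. *)
exists (Num.truncn eta^-1).+1, p; split.
- apply/eqP; rewrite eq_le p_ge0 andbT; apply: ge_sup; first by exists 0.
  move=> s [_ [//|]]; rewrite mul0r => Hs; have := fine_ge0 (measure_ge0 P [set x | r x \in `]-oo, s[]).
  by rewrite -/(H s); lra.
- apply/eqP; rewrite eq_le; apply/andP; split.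
    by apply: ge_sup; [exists 0|move=> s []].
  apply: ub_le_sup (supA _).2 _ _; split => //; right.
  apply: le_lt_trans (H1 _) _; rewrite -ltr_pdivrMr// mul1r.
  exact: truncnS_gt.
- move=> i j ij; apply: le_sup; [|exact: (supA i).1|exact: supA].
  move=> s [sB As]; exists s => //; split => //; split => //.
  case: As => [|Hs]; [by left|right; apply: lt_le_trans Hs _].
  by rewrite ler_wpM2r ?ler_nat// ltW.
move=> i.
have p_leB j : p j <= B by apply: ge_sup; [exists 0|move=> s []].
have [u [u0 um us]] : exists u : nat -> R, [/\ forall n, 0 < u n,
    forall m n, (m <= n)%N -> u n <= u m & forall e, 0 < e -> exists n, u n < e].
  exists (fun n => n.+1%:R^-1); split=> [n|m n mn|e e0]; first by rewrite invr_gt0.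
    by rewrite lef_pV2 ?posrE// ler_nat.
  by have [n _ /(_ n (leqnn _))/= ?] := near_infty_natSinv_lt (PosNum e0); exists n.
(* The gap is exhausted by intervals with both ends strictly inside it, where [Hgt] and [Hlt] bound
   [H] by [i * eta] from below and by [(i + 1) * eta] from above; the mass of the gap is the
   limit. *)
pose F (n : nat) := [set x | r x \in `[p i + u n, p i.+1 - u n[].
have mF n : measurable (F n) by exact: measurable_itv_preimage.
have -> : [set x | p i < r x < p i.+1] = \bigcup_n F n.
  apply/seteqP; split => x /=; last first.
    move=> [n _]; rewrite /F/= in_itv/= => /andP[? ?].
    by have := u0 n; move=> ?; apply/andP; split; lra.
  move=> /andP[rx1 rx2].
  pose e := Num.min (r x - p i) (p i.+1 - r x).
  have e0 : 0 < e by rewrite lt_min !subr_gt0 rx1.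
  have [n ne] := us e e0.
  exists n => //; rewrite /F/= in_itv/=.
  by move: ne; rewrite lt_min => /andP[? ?]; apply/andP; split; lra.
have ndF : nondecreasing_seq F.
  move=> m n mn; apply/subsetPset => x; rewrite /F/= !in_itv/= => /andP[? ?].
  by have := um _ _ mn => ?; apply/andP; split; lra.
have cF := nondecreasing_cvg_mu (mu := P) mF (bigcup_measurable (fun n _ => mF n)) ndF.
rewrite -(cvg_lim _ cF)//; apply: lime_le; first by apply/cvg_ex; eexists; exact: cF.
near=> n; rewrite [leLHS]/=.
set a := p i + u n; set b := p i.+1 - u n.
have n0 := u0 n.
have bB : b <= B by apply: le_trans (p_leB i.+1); rewrite /b gerBl ltW.
have [ab|ba] := leP a b; last first.
  rewrite (_ : F n = set0) ?measure0 ?lee_fin ?ltW//.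
  by apply/seteqP; split => // x; rewrite /F/= in_itv/= -/a -/b => /andP[? ?]; lra.
have Hab : ((H a)%:E + P (F n) = (H b)%:E)%E.
  rewrite -!PH -measureU//; [|exact: measurable_itv_preimage|].
    congr (P _); apply/seteqP; split => x /=; rewrite /F/= !in_itv/= -/a -/b.
      by move=> [/lt_le_trans|/andP[]//]; apply.
    by move=> rb; have [ra|ra] := ltP (r x) a; [left|right].
  apply/seteqP; split => // x [] /=; rewrite /F/= !in_itv/= -/a -/b.
  by move=> ? /andP[? ?]; lra.
have [f0 f1] : (0 <= P (F n))%E /\ P (F n) \is a fin_num.
  by split => //; exact: fin_num_measure.
move: Hab; rewrite -(fineK f1) -EFinD => -[Hab]; rewrite lee_fin.
have := Hgt i a ltac:(by rewrite /a ltrDl) (le_trans ab bB).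
have := Hlt i.+1 b ltac:(by rewrite /b gtrBl).
rewrite -natr1 mulrDl mul1r; lra.
Unshelve. all: by end_near. Qed.

(** Between two neighbouring nodes monotonicity traps both functions, so the error is at most [e]
    plus the increment of [g] over the gap. At a node the error is at most [e], hence the strict
    inequalities. *)
Lemma nondecreasing_close (g g' : R -> R) (e : R) (N : nat) (p : nat -> R) :
  {homo g : s t / s <= t} -> {homo g' : s t / s <= t} ->
  p 0 = 0 -> (forall i, (i <= N)%N -> `|g' (p i) - g (p i)| <= e) ->
  {homo p : i j / (i <= j)%N >-> i <= j} ->
  forall s, 0 <= s < p N ->
  `|g' s - g s| <= e + \sum_(i < N) (g (p i.+1) - g (p i)) * (p i < s < p i.+1)%R%:R.
Proof.
move=> gm gm' p0 gg' pm s /andP[s0 sp].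
have term_ge0 i : 0 <= (g (p i.+1) - g (p i)) * (p i < s < p i.+1)%R%:R.
  by rewrite mulr_ge0// subr_ge0 gm// pm.
have [i iN /andP[pis spi]] : exists2 i, (i < N)%N & p i <= s < p i.+1.
  elim: N sp {gg'} => [|N IH] sp; first by move: sp; rewrite p0 ltNge s0.
  have [pNs|/IH[i iN ?]] := leP (p N) s; first by exists N => //; rewrite pNs.
  by exists i => //; exact: ltnW.
rewrite (bigD1 (Ordinal iN))//=.
have rest : 0 <= \sum_(j < N | j != Ordinal iN)
    (g (p j.+1) - g (p j)) * (p j < s < p j.+1)%R%:R by exact: sumr_ge0.
have := gg' i (ltnW iN); move: pis; rewrite le_eqVlt => /predU1P[pis|pis] ge.
  have := term_ge0 i; rewrite -pis => ti; apply: le_trans ge _.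
  by rewrite lerDl; apply: addr_ge0 => //; move: rest; rewrite -pis.
move: ge; have := gg' _ iN; rewrite pis spi/= mulr1 !ler_norml => /andP[? ?] /andP[? ?].
have := gm _ _ (ltW pis); have := gm _ _ (ltW spi).
have := gm' _ _ (ltW pis); have := gm' _ _ (ltW spi).
by move=> ? ? ? ?; apply/andP; split; lra.
Qed.

(* Proximity of two monotone functions at finitely many points, depending only
   on the law of [r], controls the [L^2] distance of their compositions
   with [r]. *)
Lemma nondecreasing_norm2_close (c e : R) : 0 < c -> 0 < e ->
  exists s : seq R, exists2 e', 0 < e' & forall g g' : R -> R,
    {homo g : s t / s <= t} -> {homo g' : s t / s <= t} ->
    (forall s, 0 <= g s <= c) -> (forall s, 0 <= g' s <= c) ->
    (forall q, q \in s -> `|g' q - g q| < e') ->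
    norm2 P ((g' \o r) \- (g \o r)) < e.
Proof.
(* Bounding one factor of the squared difference by [c] and the other by [D] leaves
   [c * (e' + c * eta)]; [eta] and [e'] make each of the two terms [e ^+ 2 / 4]. *)
move=> c0 e0; pose eta := e ^+ 2 / (4 * c ^+ 2).
have eta0 : 0 < eta by rewrite divr_gt0 ?mulr_gt0 ?exprn_gt0.
have [N [p [p0 pN pm pP]]] := quantiles eta0.
pose e' := e ^+ 2 / (4 * c).
have e'0 : 0 < e' by rewrite divr_gt0 ?mulr_gt0 ?exprn_gt0.
exists [seq p i | i <- iota 0 N.+1], e' => // g g' gm gm' gc gc' gg'.
have mg h : {homo h : s t / s <= t} -> (forall s, 0 <= h s <= c) ->
    measurable_fun setT (h \o r).
  move=> hm _; apply: measurableT_comp => //.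
  exact: nondecreasing_measurable.
have bd s : `|g' s - g s| <= c.
  by have /andP[? ?] := gc s; have /andP[? ?] := gc' s; rewrite ler_norml; apply/andP; split; lra.
have mgg : measurable_fun setT ((g' \o r) \- (g \o r)).
  by apply: measurable_funB; exact: mg.
have lgg : (g' \o r) \- (g \o r) \in Lfun P 2%:E.
  by apply: (@bounded_Lfun2 _ _ _ P _ c mgg) => x; exact: bd.
have pgg' i : (i <= N)%N -> `|g' (p i) - g (p i)| <= e'.
  by move=> iN; apply/ltW/gg'/map_f; rewrite mem_iota add0n ltnS iN.
pose I i := [set x | r x \in `]p i, p i.+1[].
have mI i : measurable (I i) by exact: measurable_itv_preimage.
pose D x := e' + \sum_(i < N) (g (p i.+1) - g (p i)) * \1_(I i) x.
have gD x : `|g' (r x) - g (r x)| <= D x.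
  have := nondecreasing_close gm gm' p0 pgg' pm (s := r x) _.
  rewrite pN => /(_ (rB x)); rewrite /D => /le_trans; apply.
  rewrite lerD2l; apply: ler_sum => i _; rewrite indicE.
  suff -> : (x \in I i) = (p i < r x < p i.+1) by [].
  by apply/idP/idP => [/set_mem|h]; last apply/mem_set; rewrite /I/= in_itv.
have iI i : P.-integrable setT (EFin \o (\1_(I i) : T -> R)).
  apply: Lfun2_integrable; apply: (@bounded_Lfun2 _ _ _ _ _ 1).
    exact: measurable_indic.
  by move=> x; rewrite indicE ger0_norm// lern1 leq_b1.
(* Each gap has mass at most [eta], so the integrals of the increments telescope to the total
   increment of [g] times [eta]. *)
have iS n : P.-integrable setT
    (EFin \o (fun x => \sum_(i < n) (g (p i.+1) - g (p i)) * \1_(I i) x)) /\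
    \int[P]_x (\sum_(i < n) (g (p i.+1) - g (p i)) * \1_(I i) x) <=
    (g (p n) - g (p 0)) * eta.
  elim: n => [|n [IH1 IH2]].
    rewrite subrr mul0r (_ : (fun _ => _) = cst 0); last first.
      by apply/funext => x; rewrite big_ord0.
    split; last by rewrite /Rintegral integral0.
    exact/Lfun2_integrable/Lfun_cst.
  have i1 : P.-integrable setT (EFin \o (fun x => (g (p n.+1) - g (p n)) * \1_(I n) x)).
    rewrite (_ : _ \o _ = (fun x => (g (p n.+1) - g (p n))%:E * (\1_(I n) x)%:E)%E)//.
    by apply: integrableZl => //; exact: iI.
  rewrite (_ : (fun _ => _) = (fun x => (\sum_(i < n) (g (p i.+1) - g (p i)) * \1_(I i) x)
     + (g (p n.+1) - g (p n)) * \1_(I n) x)); last first.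
    by apply/funext => x; rewrite big_ord_recr.
  split.
    by rewrite (_ : _ \o _ = (fun x => (\sum_(i < n) (g (p i.+1) - g (p i)) * \1_(I i) x)%:E
       + ((g (p n.+1) - g (p n)) * \1_(I n) x)%:E)%E)//; apply: integrableD.
  rewrite RintegralD// RintegralZl//.
  have : \int[P]_x \1_(I n) x <= eta.
    rewrite /Rintegral integral_indic// setIT -lee_fin fineK ?fin_num_measure//.
    by apply: le_trans (pP n); rewrite (_ : [set x | p n < r x < p n.+1] = I n).
  have : 0 <= g (p n.+1) - g (p n) by rewrite subr_ge0 gm// pm.
  move=> gn0 /(ler_wpM2l gn0); lra.
have [iSN SN] := iS N.
rewrite -(@ltr_pXn2r _ 2) ?nnegrE ?norm2_ge0 ?(ltW e0)//.
rewrite -int_sqr//.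
have iD : P.-integrable setT (EFin \o D).
  rewrite (_ : _ \o _ = (fun x => (cst e' x)%:E +
     (\sum_(i < N) (g (p i.+1) - g (p i)) * \1_(I i) x)%:E)%E)//.
  by apply: integrableD => //; exact/Lfun2_integrable/Lfun_cst.
apply: (@le_lt_trans _ _ (\int[P]_x (c * D x))).
  apply: le_Rintegral => //.
  - exact: Lfun2_integrable_sqr.
  - rewrite (_ : _ \o _ = (fun x => c%:E * (D x)%:E)%E)//.
    by apply: integrableZl.
  move=> x _; rewrite -real_normK ?num_real// expr2.
  by apply: ler_pM => //; [exact: bd|exact: gD].
rewrite RintegralZl// /D RintegralD//; last exact/Lfun2_integrable/Lfun_cst.
have -> : \int[P]_x e' = e'.
  by rewrite (Rintegral_cst P measurableT) [X in fine X]probability_setT mulr1.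
have : (g (p N) - g (p 0)) * eta <= c * eta.
  rewrite ler_wpM2r ?(ltW eta0)//.
  by have /andP[? ?] := gc (p N); have /andP[? ?] := gc (p 0); lra.
move=> h; apply: (@le_lt_trans _ _ (c * (e' + c * eta))).
  by rewrite ler_wpM2l ?(ltW c0)// lerD2l; exact: le_trans h.
have -> : c * (e' + c * eta) = e ^+ 2 / 2.
  by rewrite /e' /eta; field; rewrite gt_eqF.
have : 0 < e ^+ 2 by rewrite exprn_gt0.
lra.
Qed.

End quantiles.

(** * Distances in Theta through real lifts, and compactness *)

Section circle_lemmas.
Variable R : realType.
Implicit Types a b : circle R.

Lemma circle_norm_to_circle (s : R) : circle_norm (to_circle s) <= `|s|.
Proof. by have [t ts [-> min_t]] := circle_normP (to_circle s); exact: min_t. Qed.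

End circle_lemmas.

Section Theta_lemmas.
Variable R : realType.
Notation mu := (@lebesgue01 R).
Notation L2 := (Lfun mu 2%:E).
Implicit Types (theta phi : Theta R).

Lemma mdist_Theta theta phi : mdist theta phi = d_Theta theta phi.
Proof. by []. Qed.

Lemma Theta_of_fun (f : measurableTypeR R -> circle R) : measurable_fun setT f ->
  exists theta : Theta R, {ae mu, forall x, theta x = f x}.
Proof.
move=> mf; pose F := mfun_Sub (mem_set mf).
exists (\pi_({mfun_ mu, measurableTypeR R >-> circle R}) F)%qT.
have := reprK (\pi_({mfun_ mu, measurableTypeR R >-> circle R}) F)%qT.
move=> /eqquotP/asboolP; by apply: filterS => x /(_ I).
Qed.

Lemma circle_norm_Lfun2 theta phi :
  (fun x => circle_norm (theta x - phi x)) \in L2.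
Proof.
apply: (@bounded_Lfun2 _ _ _ mu _ (pi *+ 2)).
  apply: measurableT_comp; first exact: measurable_circle_norm.
  by apply: measurable_circleB; exact: measurable_Theta.
by move=> x; rewrite ger0_norm ?circle_norm_ge0// circle_norm_le.
Qed.

Lemma d_Theta_norm2 theta phi :
  d_Theta theta phi = norm2 mu (fun x => circle_norm (theta x - phi x)).
Proof.
rewrite /d_Theta int_sqr ?circle_norm_Lfun2// sqrtr_sqr ger0_norm//.
exact: norm2_ge0.
Qed.

Lemma d_Theta_le theta phi (f : R -> R) : f \in L2 ->
  {ae mu, forall x, theta x = phi x + to_circle (f x)} ->
  d_Theta theta phi <= norm2 mu f.
Proof.
move=> lf tf; rewrite d_Theta_norm2; apply: le_norm2 => //.
  exact: circle_norm_Lfun2.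
apply: filterS tf => x ->; rewrite addrC addrA addNr add0r.
by rewrite ger0_norm ?circle_norm_ge0// circle_norm_to_circle.
Qed.

Import ArrowAsProduct.

(** Under [ArrowAsProduct] the space [R -> R] has the topology of pointwise convergence, so this is
    Tychonoff. *)
Lemma compact_box (c : R) :
  compact [set g : R -> R | forall s, `[0, c]%classic (g s)].
Proof.
exact: (@tychonoff R (fun _ => R : topologicalType) (fun _ => `[0, c]%classic)
  (fun _ => @segment_compact R 0 c)).
Qed.

(** Monotone maps form a closed part of the box, and [g |-> to_circle \o g \o r] is continuous from
    pointwise convergence to the metric of Theta, because by [nondecreasing_norm2_close] finitely
    many values control the distance. *)
Lemma compact_monotone_images (r : R -> R) (B c : R) : 0 < c ->
  measurable_fun setT r -> (forall x, 0 <= r x < B) ->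
  exists2 A : set (Theta R), compact A & forall (g : R -> R) theta,
    {homo g : s t / s <= t} -> (forall s, 0 <= g s <= c) ->
    {ae mu, forall x, theta x = to_circle (g (r x))} -> A theta.
Proof.
move=> c0 mr rB.
(* [J] must be total, but [g \o r] is known to be measurable only for monotone [g]; any other [g] is
   sent to a constant class. *)
have /choice[J JP] : forall g : R -> R, exists theta, {homo g : s t / s <= t} ->
    {ae mu, forall x, theta x = to_circle (g (r x))}.
  move=> g; have [gm|ngm] := pselect {homo g : s t / s <= t}; last first.
    have [z _] := Theta_of_fun (measurable_cst (to_circle (0 : R))).
    by exists z => /ngm.
  have [|theta h] := @Theta_of_fun (fun x => to_circle (g (r x))).
    apply: (measurableT_comp (@measurable_to_circle R)).
    by apply: measurableT_comp => //; exact: nondecreasing_measurable.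
  by exists theta.
pose M := [set g : R -> R |
  {homo g : s t / s <= t} /\ forall s, 0 <= g s <= c].
have near_eval (p : R -> R) (q e : R) : 0 < e ->
    \forall g \near nbhs p, `|p q - g q| < e.
  move=> e0; exact: (@proj_continuous R (fun _ => R : topologicalType) q p _ (nbhsx_ballx (p q) e e0)).
have cM : compact M.
  have cbox := @compact_box c.
  apply: (subclosed_compact _ cbox); last first.
    by move=> g [_ gc] s /=; rewrite in_itv/=; exact: gc.
  (* Two points at once, since monotonicity of the limit compares two values of one approximant. *)
  move=> p clp; have approx q q' e : 0 < e ->
      exists g, [/\ M g, `|p q - g q| < e & `|p q' - g q'| < e].
    move=> e0; have [g [Mg [pq pq']]] :=
      clp _ (filterI (near_eval p q e e0) (near_eval p q' e e0)).
    by exists g.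
  split=> [s t st|s].
    apply/ler_addgt0Pr => e e0; have e20 : 0 < e / 2 by rewrite divr_gt0.
    have [g [[/(_ _ _ st) gst _]]] := approx s t _ e20.
    by rewrite !ltr_norml => /andP[? ?] /andP[? ?]; lra.
  apply/andP; split; apply/ler_addgt0Pr => e e0;
    have [g [[_ /(_ s)/andP[g0 gc]]]] := approx s s _ e0;
    by rewrite !ltr_norml => /andP[? ?] /andP[? ?]; lra.
exists (J @` M).
  apply: continuous_compact cM.
  apply/subspace_continuousP => g [gm gc].
  apply/metricType_numDomainType.cvgrPdist_lt => e e0.
  have [s [e' e'0 H]] := nondecreasing_norm2_close mu mr rB c0 e0.
  have near_s0 : \forall g' \near nbhs (g : R -> R),
      forall q, q \in s -> `|g' q - g q| < e'.
    elim: s {H} => [|q s IH]; first by apply: filterE.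
    apply: filterS2 IH (near_eval g q e' e'0) => g' IH gq q'.
    by rewrite inE => /predU1P[->|]; [rewrite distrC|exact: IH].
  have near_s : \forall g' \near within M (nbhs (g : R -> R)),
      forall q, q \in s -> `|g' q - g q| < e'.
    by apply: filterS near_s0 => g' gg' _.
  have near_M : \forall g' \near within M (nbhs (g : R -> R)), M g'.
    exact: withinT.
  near=> g'.
  have [gm' gc'] : M g' by near: g'.
  rewrite mdist_Theta d_Theta_sym.
  apply: le_lt_trans (H g g' gm gm' gc gc' _); last by near: g'.
  apply: d_Theta_le; last first.
    apply: filterS2 (JP g gm) (JP g' gm') => x -> ->.
    by rewrite -to_circleD /= subrKC.
  have mh (h : R -> R) : {homo h : s t / s <= t} -> measurable_fun setT (h \o r).
    by move=> hm; apply: measurableT_comp => //; exact: nondecreasing_measurable.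
  apply: (@bounded_Lfun2 _ _ _ mu _ c).
    by apply: measurable_funB; exact: mh.
  move=> x; have /andP[? ?] := gc (r x); have /andP[? ?] := gc' (r x).
  by rewrite ler_norml /=; apply/andP; split; lra.
move=> g theta gm gc tg; exists g; first by split.
apply/Theta_eqP; apply: filterS2 tg (JP g gm) => x -> ->.
by [].
Unshelve. all: by end_near. Qed.

End Theta_lemmas.

(** * Velocity field and energy *)

Section trigonometric_bounds.
Variable R : realType.
Implicit Types a s t : R.

Lemma MVT_at0 (f df : R -> R) : (forall x : R, is_derive x (1 : R) f (df x)) ->
  forall s, exists2 c, `|c| <= `|s| & f s - f 0 = df c * s.
Proof.
move=> fdf s; have cf : continuous f.
  by move=> x; apply/differentiable_continuous/derivable1_diffP; case: (fdf x).
have [s0|s0] := leP 0 s.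
  have [c] := MVT_segment s0 (fun x _ => fdf x) (continuous_subspaceT cf).
  rewrite in_itv/= => /andP[c0 cs]; rewrite subr0 => E.
  by exists c => //; rewrite !ger0_norm.
have [c] := MVT_segment (ltW s0) (fun x _ => fdf x) (continuous_subspaceT cf).
rewrite in_itv/= => /andP[sc c0] E; exists c; last by rewrite -opprB E; ring.
by rewrite !ler0_norm ?lerN2// ltW.
Qed.

Lemma norm_sin_le s : `|sin s| <= `|s|.
Proof.
have [c _] := MVT_at0 (@is_derive_sin R) s.
rewrite sin0 subr0 => ->; rewrite normrM.
by rewrite ler_piMl// cos_max.
Qed.

Lemma norm_cosB1_le s : `|cos s - 1| <= `|s|.
Proof.
have [c _] := MVT_at0 (@is_derive_cos R) s.
rewrite cos0 => ->; rewrite normrM normrN.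
by rewrite ler_piMl// sin_max.
Qed.

Lemma norm_cosB1_le_sqr s : `|cos s - 1| <= s ^+ 2.
Proof.
have [c cs] := MVT_at0 (@is_derive_cos R) s.
rewrite cos0 => ->; rewrite normrM normrN -(real_normK (num_real s)) expr2.
by rewrite ler_wpM2r// (le_trans (norm_sin_le c)).
Qed.

Lemma norm_sinB_le_sqr s : `|sin s - s| <= s ^+ 2.
Proof.
have [c cs] := @MVT_at0 (fun x => sin x - x) (fun x => cos x - 1) _ s.
rewrite sin0 !subr0 => ->; rewrite normrM -(real_normK (num_real s)) expr2.
by rewrite ler_wpM2r// (le_trans (norm_cosB1_le c)).
Qed.

Lemma sin_lip a s : `|sin (a + s) - sin a| <= `|s|.
Proof.
have dsin x : is_derive x (1 : R) (sin \o (fun x => a + x)) (cos (a + x)).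
  by apply: is_derive_eq; rewrite add0r !mulr1.
have [c cs /=] := MVT_at0 dsin s.
by rewrite addr0 => ->; rewrite normrM ler_piMl// cos_max.
Qed.

Lemma cos_lip a s : `|cos (a + s) - cos a| <= `|s|.
Proof.
by rewrite -!sinDpihalf [a + s + _]addrAC; exact: sin_lip.
Qed.

(** The addition formula reduces this to the expansions of cos and sin at 0, each costing at most
    one [s ^+ 2]. *)
Lemma cos_taylor a s : `|cos (a + s) - (cos a - s * sin a)| <= 2 * s ^+ 2.
Proof.
have -> : cos (a + s) - (cos a - s * sin a) =
    cos a * (cos s - 1) - sin a * (sin s - s) by rewrite cosD; ring.
apply: le_trans (ler_normB _ _) _; rewrite !normrM mulr2n mulrDl mul1r lerD//.
  by rewrite (le_trans _ (norm_cosB1_le_sqr s))// ler_piMl// cos_max.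
by rewrite (le_trans _ (norm_sinB_le_sqr s))// ler_piMl// sin_max.
Qed.

Lemma sin_taylor a s : `|sin (a + s) - (sin a + s * cos a)| <= 2 * s ^+ 2.
Proof.
have -> : sin (a + s) - (sin a + s * cos a) =
    sin a * (cos s - 1) + cos a * (sin s - s) by rewrite sinD; ring.
apply: le_trans (ler_normD _ _) _; rewrite !normrM mulr2n mulrDl mul1r lerD//.
  by rewrite (le_trans _ (norm_cosB1_le_sqr s))// ler_piMl// sin_max.
by rewrite (le_trans _ (norm_sinB_le_sqr s))// ler_piMl// cos_max.
Qed.

End trigonometric_bounds.

Section circle_trigo.
Variable R : realType.
Implicit Types a b : circle R.

Lemma to_circle_mul2 (s : R) : to_circle s *+ 2 = to_circle (2 * s).
Proof. by rewrite mulr2n -to_circleD mulr_natl mulr2n. Qed.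

Lemma circle_sin_max a : `|circle_sin a| <= 1.
Proof. exact: sin_max. Qed.

Lemma circle_cos_max a : `|circle_cos a| <= 1.
Proof. exact: cos_max. Qed.

Lemma circle_sin_lip a b : `|circle_sin a - circle_sin b| <= circle_norm (a - b).
Proof.
have [s sab [-> _]] := circle_normP (a - b).
have -> : a = b + to_circle s by rewrite sab addrC subrK.
by rewrite -(to_circle_rep b) -to_circleD !circle_sinE sin_lip.
Qed.

Lemma circle_cos_lip a b : `|circle_cos a - circle_cos b| <= circle_norm (a - b).
Proof.
have [s sab [-> _]] := circle_normP (a - b).
have -> : a = b + to_circle s by rewrite sab addrC subrK.
by rewrite -(to_circle_rep b) -to_circleD !circle_cosE cos_lip.
Qed.

Lemma circle_sinB a b :
  circle_sin (a - b) = circle_sin a * circle_cos b - circle_cos a * circle_sin b.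
Proof.
rewrite -(to_circle_rep a) -(to_circle_rep b) -to_circleB.
by rewrite !circle_sinE !circle_cosE sinB.
Qed.

Lemma circle_cosB a b :
  circle_cos (a - b) = circle_cos a * circle_cos b + circle_sin a * circle_sin b.
Proof.
rewrite -(to_circle_rep a) -(to_circle_rep b) -to_circleB.
by rewrite !circle_sinE !circle_cosE cosB.
Qed.

Lemma circle_sin_mul2 a : circle_sin (a *+ 2) = 2 * circle_sin a * circle_cos a.
Proof.
rewrite -(to_circle_rep a) to_circle_mul2 !circle_sinE circle_cosE mulr_natl.
by rewrite sin_mulr2n; ring.
Qed.

Lemma circle_cos_mul2 a : circle_cos (a *+ 2) = 2 * circle_cos a ^+ 2 - 1.
Proof.
rewrite -(to_circle_rep a) to_circle_mul2 !circle_cosE mulr_natl.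
by rewrite cos_mulr2n; ring.
Qed.

Lemma circle_norm_mul2 a : circle_norm (a *+ 2) <= 2 * circle_norm a.
Proof. by rewrite mulr2n mulr_natl mulr2n circle_normD. Qed.

Lemma measurable_circle_sin : measurable_fun setT (@circle_sin R).
Proof.
rewrite (_ : @circle_sin R = sin \o @circle_rep R); last first.
  by apply/funext => a /=; rewrite -circle_sinE to_circle_rep.
apply: measurableT_comp; last exact: measurable_circle_rep.
by apply: continuous_measurable_fun; exact: continuous_sin.
Qed.

Lemma measurable_circle_cos : measurable_fun setT (@circle_cos R).
Proof.
rewrite (_ : @circle_cos R = cos \o @circle_rep R); last first.
  by apply/funext => a /=; rewrite -circle_cosE to_circle_rep.
apply: measurableT_comp; last exact: measurable_circle_rep.
by apply: continuous_measurable_fun; exact: continuous_cos.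
Qed.

End circle_trigo.

Section circle_integrals.
Variable R : realType.
Notation mu := (@lebesgue01 R).
Notation L2 := (Lfun mu 2%:E).
Implicit Types (theta phi : Theta R) (f : circle R -> R).

Lemma circle_comp_Lfun2 f theta c : measurable_fun setT f ->
  (forall a, `|f a| <= c) -> (fun x => f (theta x)) \in L2.
Proof.
move=> mf fc; apply: (@bounded_Lfun2 _ _ _ mu _ c) => // x.
by apply: measurableT_comp => //; exact: measurable_Theta.
Qed.

Lemma sin_Lfun2 theta : (fun x => circle_sin (theta x)) \in L2.
Proof. exact: circle_comp_Lfun2 (@measurable_circle_sin R) (@circle_sin_max R). Qed.

Lemma cos_Lfun2 theta : (fun x => circle_cos (theta x)) \in L2.
Proof. exact: circle_comp_Lfun2 (@measurable_circle_cos R) (@circle_cos_max R). Qed.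

Lemma measurable_circle_sin2 :
  measurable_fun setT (fun a : circle R => circle_sin (a *+ 2)).
Proof.
under eq_fun do rewrite circle_sin_mul2 -mulrA.
apply: measurable_funM => //; apply: measurable_funM.
  exact: measurable_circle_sin.
exact: measurable_circle_cos.
Qed.

Lemma measurable_circle_cos2 :
  measurable_fun setT (fun a : circle R => circle_cos (a *+ 2)).
Proof.
under eq_fun do rewrite circle_cos_mul2.
apply: measurable_funB => //; apply: measurable_funM => //.
by apply: measurable_funX; exact: measurable_circle_cos.
Qed.

Lemma sin2_Lfun2 theta : (fun x => circle_sin (theta x *+ 2)) \in L2.
Proof.
apply: (@circle_comp_Lfun2 (fun a => circle_sin (a *+ 2)) theta 1).
  exact: measurable_circle_sin2.
by move=> a; exact: circle_sin_max.
Qed.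

Lemma cos2_Lfun2 theta : (fun x => circle_cos (theta x *+ 2)) \in L2.
Proof.
apply: (@circle_comp_Lfun2 (fun a => circle_cos (a *+ 2)) theta 1).
  exact: measurable_circle_cos2.
by move=> a; exact: circle_cos_max.
Qed.

Lemma circle_int_lip f theta phi (k c : R) : 0 <= k -> measurable_fun setT f ->
  (forall a, `|f a| <= c) ->
  (forall a b, `|f a - f b| <= k * circle_norm (a - b)) ->
  `|\int[mu]_x f (theta x) - \int[mu]_x f (phi x)| <= k * d_Theta theta phi.
Proof.
move=> k0 mf fc fk; have lt := circle_comp_Lfun2 theta mf fc.
have lp := circle_comp_Lfun2 phi mf fc.
rewrite -RintegralB//; [|exact: Lfun2_integrable..].
apply: le_trans (norm_int_le (Lfun2B lt lp)) _.
have ln := circle_norm_Lfun2 theta phi.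
rewrite d_Theta_norm2 -[X in X * _]ger0_norm// -norm2Z//.
apply: le_norm2; [exact: Lfun2B|exact: Lfun2Z|].
apply: aeW => x /=; rewrite [leRHS]ger0_norm ?fk// mulr_ge0//.
exact: circle_norm_ge0.
Qed.

End circle_integrals.

(** * Moments, Lipschitz bounds and the gradient structure *)

Section velocity_energy.
Variables (R : realType) (K Ks : R).
Notation mu := (@lebesgue01 R).
Notation L2 := (Lfun mu 2%:E).
Implicit Types (theta phi : Theta R) (a b : circle R).

(** [mcos] and [msin] are the real and imaginary parts of the order parameter. The interaction
    depends on [theta] only through them, so the double integral of the energy reduces to a squared
    modulus. *)
Let mcos theta := \int[mu]_x circle_cos (theta x).
Let msin theta := \int[mu]_x circle_sin (theta x).
Let mcos2 theta := \int[mu]_x circle_cos (theta x *+ 2).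

Definition velocity_field theta (x : R) := velocity K Ks theta (theta x).

Lemma int_lincomb (f g : R -> R) (s t : R) : f \in L2 -> g \in L2 ->
  \int[mu]_x (s * f x + t * g x) = s * \int[mu]_x f x + t * \int[mu]_x g x.
Proof.
move=> lf lg; have i1 := Lfun2_integrable lf; have i2 := Lfun2_integrable lg.
rewrite RintegralD//; [|exact: (Lfun2_integrable (Lfun2Z s lf))
  |exact: (Lfun2_integrable (Lfun2Z t lg))].
by rewrite !RintegralZl.
Qed.

Lemma velocityE theta a : velocity K Ks theta a =
  K * (circle_sin a * mcos theta - circle_cos a * msin theta)
  - Ks * circle_sin (a *+ 2).
Proof.
rewrite /velocity; congr (_ * _ - _).
under eq_Rintegral do rewrite circle_sinB -mulNr.
by rewrite int_lincomb ?mulNr//; [exact: cos_Lfun2|exact: sin_Lfun2].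
Qed.

Lemma energyE theta : energy K Ks theta =
  K / 2 * (mcos theta ^+ 2 + msin theta ^+ 2) - Ks / 2 * mcos2 theta.
Proof.
rewrite /energy; congr (_ * _ - _).
under eq_Rintegral => x _.
  under eq_Rintegral do rewrite circle_cosB.
  rewrite int_lincomb; [|exact: cos_Lfun2|exact: sin_Lfun2].
  rewrite [X in X + _]mulrC [X in _ + X]mulrC; over.
by rewrite int_lincomb ?expr2//; [exact: cos_Lfun2|exact: sin_Lfun2].
Qed.

Lemma mcos_max theta : `|mcos theta| <= 1.
Proof.
apply: le_trans (norm_int_le (cos_Lfun2 theta)) _.
by apply: norm2_le => //; [exact: cos_Lfun2|apply: aeW => x; exact: circle_cos_max].
Qed.

Lemma msin_max theta : `|msin theta| <= 1.
Proof.
apply: le_trans (norm_int_le (sin_Lfun2 theta)) _.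
by apply: norm2_le => //; [exact: sin_Lfun2|apply: aeW => x; exact: circle_sin_max].
Qed.

Lemma mcos2_max theta : `|mcos2 theta| <= 1.
Proof.
apply: le_trans (norm_int_le (cos2_Lfun2 theta)) _.
by apply: norm2_le => //; [exact: cos2_Lfun2|apply: aeW => x; exact: circle_cos_max].
Qed.

Lemma mcos_lip theta phi : `|mcos theta - mcos phi| <= d_Theta theta phi.
Proof.
rewrite -[leRHS]mul1r; apply: (@circle_int_lip _ (@circle_cos R) _ _ 1 1) => //.
- exact: measurable_circle_cos.
- exact: circle_cos_max.
- by move=> a b; rewrite mul1r circle_cos_lip.
Qed.

Lemma msin_lip theta phi : `|msin theta - msin phi| <= d_Theta theta phi.
Proof.
rewrite -[leRHS]mul1r; apply: (@circle_int_lip _ (@circle_sin R) _ _ 1 1) => //.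
- exact: measurable_circle_sin.
- exact: circle_sin_max.
- by move=> a b; rewrite mul1r circle_sin_lip.
Qed.

Lemma mcos2_lip theta phi : `|mcos2 theta - mcos2 phi| <= 2 * d_Theta theta phi.
Proof.
apply: (@circle_int_lip _ (fun a => circle_cos (a *+ 2)) _ _ 2 1) => //.
- exact: measurable_circle_cos2.
- by move=> a; exact: circle_cos_max.
- move=> a b; apply: le_trans (circle_cos_lip _ _) _.
  by rewrite -mulrnBl circle_norm_mul2.
Qed.

Lemma energy_lip theta phi :
  `|energy K Ks theta - energy K Ks phi| <= (2 * `|K| + `|Ks|) * d_Theta theta phi.
Proof.
have d0 : 0 <= d_Theta theta phi by rewrite -mdist_Theta mdist_ge0.
have sq (s t d : R) : `|s| <= 1 -> `|t| <= 1 -> `|s - t| <= d ->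
    `|s ^+ 2 - t ^+ 2| <= 2 * d.
  move=> s1 t1 st; rewrite subr_sqr normrM mulrC ler_pM//.
  by apply: le_trans (ler_normD _ _) _; lra.
have h1 := sq _ _ _ (mcos_max theta) (mcos_max phi) (mcos_lip theta phi).
have h2 := sq _ _ _ (msin_max theta) (msin_max phi) (msin_lip theta phi).
have h3 := mcos2_lip theta phi; rewrite !energyE.
set c := mcos theta in h1 *; set c' := mcos phi in h1 *.
set s := msin theta in h2 *; set s' := msin phi in h2 *.
set w := mcos2 theta in h3 *; set w' := mcos2 phi in h3 *.
have -> : K / 2 * (c ^+ 2 + s ^+ 2) - Ks / 2 * w - (K / 2 * (c' ^+ 2 + s' ^+ 2) - Ks / 2 * w')
  = K * (((c ^+ 2 - c' ^+ 2) + (s ^+ 2 - s' ^+ 2)) / 2) - Ks * ((w - w') / 2) by field.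
apply: le_trans (ler_normB _ _) _; rewrite !normrM.
rewrite (_ : (2 * `|K| + `|Ks|) * d_Theta theta phi =
  `|K| * (2 * d_Theta theta phi) + `|Ks| * d_Theta theta phi); last ring.
apply: lerD.
  rewrite ler_wpM2l// [`|2^-1|]ger0_norm//.
  have := ler_normD (c ^+ 2 - c' ^+ 2) (s ^+ 2 - s' ^+ 2); lra.
rewrite ler_wpM2l// [`|2^-1|]ger0_norm//; lra.
Qed.

Lemma energy_ge theta : - (`|K| + `|Ks|) <= energy K Ks theta.
Proof.
have sq (s : R) : `|s| <= 1 -> `|s ^+ 2| <= 1.
  by move=> s1; rewrite normrX expr_le1.
have h1 := sq _ (mcos_max theta); have h2 := sq _ (msin_max theta).
have h3 := mcos2_max theta; rewrite energyE.
rewrite -[leRHS]opprK lerN2; apply: le_trans (ler_norm _) _.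
rewrite normrN; apply: le_trans (ler_normB _ _) _.
rewrite -!mulrA !normrM [`|2^-1|]ger0_norm// lerD//.
  rewrite -[leRHS]mulr1 ler_wpM2l//.
  by have := ler_normD (mcos theta ^+ 2) (msin theta ^+ 2); lra.
by rewrite -[leRHS]mulr1 ler_wpM2l//; lra.
Qed.

Lemma velocity_max theta a : `|velocity K Ks theta a| <= `|K| + `|Ks|.
Proof.
rewrite /velocity; apply: le_trans (ler_normB _ _) _; rewrite !normrM.
have l : (fun y => circle_sin (a - theta y)) \in L2.
  under eq_fun do rewrite circle_sinB.
  exact: (Lfun2B (Lfun2Z _ (cos_Lfun2 theta)) (Lfun2Z _ (sin_Lfun2 theta))).
rewrite lerD// ler_piMr ?circle_sin_max//.
apply: le_trans (norm_int_le l) _; apply: norm2_le => //.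
by apply: aeW => y; exact: circle_sin_max.
Qed.

(** The 2 comes from the doubled angle. A change of configuration costs only [|K|], as [theta]
    enters through the mean alone. *)
Lemma velocity_lip theta phi a b :
  `|velocity K Ks theta a - velocity K Ks phi b| <=
  (`|K| + 2 * `|Ks|) * circle_norm (a - b) + `|K| * d_Theta theta phi.
Proof.
have l (psi : Theta R) c : (fun y => circle_sin (c - psi y)) \in L2.
  under eq_fun do rewrite circle_sinB.
  exact: (Lfun2B (Lfun2Z _ (cos_Lfun2 psi)) (Lfun2Z _ (sin_Lfun2 psi))).
rewrite /velocity.
have -> : K * \int[mu]_y circle_sin (a - theta y) - Ks * circle_sin (a *+ 2) -
    (K * \int[mu]_y circle_sin (b - phi y) - Ks * circle_sin (b *+ 2)) =
    K * (\int[mu]_y circle_sin (a - theta y) - \int[mu]_y circle_sin (b - phi y))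
    - Ks * (circle_sin (a *+ 2) - circle_sin (b *+ 2)) by ring.
apply: le_trans (ler_normB _ _) _; rewrite !normrM.
have -> : (`|K| + 2 * `|Ks|) * circle_norm (a - b) + `|K| * d_Theta theta phi =
  `|K| * (circle_norm (a - b) + d_Theta theta phi) + `|Ks| * (2 * circle_norm (a - b)) by ring.
apply: lerD; rewrite ler_wpM2l//; last first.
  by rewrite (le_trans (circle_sin_lip _ _))// -mulrnBl circle_norm_mul2.
rewrite -RintegralB//; [|exact: Lfun2_integrable (l _ _)..].
apply: le_trans (norm_int_le (Lfun2B (l theta a) (l phi b))) _.
rewrite -[X in X + _]ger0_norm ?circle_norm_ge0// -(norm2_cst mu) d_Theta_norm2.
have lc : cst (circle_norm (a - b)) \in L2 by exact: Lfun_cst.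
have ln := circle_norm_Lfun2 theta phi.
apply: le_trans (norm2D lc ln); apply: le_norm2; [exact: Lfun2B|exact: Lfun2D|].
apply: aeW => y /=; rewrite [leRHS]ger0_norm ?addr_ge0 ?circle_norm_ge0//.
apply: le_trans (circle_sin_lip _ _) _.
rewrite (_ : a - theta y - (b - phi y) = (a - b) - (theta y - phi y)); last first.
  rewrite !opprB -!addrA; congr (_ + _).
  by rewrite addrCA [in RHS]addrCA; congr (_ + _); exact: addrC.
by apply: le_trans (circle_normD _ _) _; rewrite circle_normN.
Qed.

Lemma measurable_velocity theta : measurable_fun setT (velocity K Ks theta).
Proof.
rewrite (funext (velocityE theta)).
apply: measurable_funB; last first.
  by apply: measurable_funM => //; exact: measurable_circle_sin2.
apply: measurable_funM => //; apply: measurable_funB; apply: measurable_funM => //.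
  exact: measurable_circle_sin.
exact: measurable_circle_cos.
Qed.

Lemma velocity_field_Lfun2 theta : velocity_field theta \in L2.
Proof. exact: circle_comp_Lfun2 (measurable_velocity theta) (velocity_max theta). Qed.

Lemma norm2_velocity_field_le theta :
  norm2 mu (velocity_field theta) <= `|K| + `|Ks|.
Proof.
apply: norm2_le; [exact: velocity_field_Lfun2|exact: addr_ge0|].
by apply: aeW => x; exact: velocity_max.
Qed.

Lemma norm2_velocity_field_lip theta phi :
  norm2 mu (velocity_field theta) <= norm2 mu (velocity_field phi) +
    2 * (`|K| + `|Ks|) * d_Theta theta phi.
Proof.
have lt := velocity_field_Lfun2 theta; have lp := velocity_field_Lfun2 phi.
have d0 : 0 <= d_Theta theta phi by rewrite -mdist_Theta mdist_ge0.
have -> : velocity_field theta =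
    velocity_field phi \+ (velocity_field theta \- velocity_field phi).
  by apply/funext => x /=; rewrite addrC subrK.
apply: le_trans (norm2D lp (Lfun2B lt lp)) _; rewrite lerD2l.
have ln := circle_norm_Lfun2 theta phi.
pose f := (`|K| + 2 * `|Ks|) \*: (fun x : R => circle_norm (theta x - phi x)).
pose g : R -> R := cst (`|K| * d_Theta theta phi).
have lf : f \in L2 by exact: Lfun2Z.
have lg : g \in L2 by exact: Lfun_cst.
apply: (@le_trans _ _ (norm2 mu (f \+ g))).
  apply: le_norm2; [exact: Lfun2B|exact: Lfun2D|].
  apply: aeW => x; rewrite [leRHS]ger0_norm; first exact: velocity_lip.
  by rewrite addr_ge0 ?mulr_ge0 ?addr_ge0 ?mulr_ge0 ?circle_norm_ge0.
apply: le_trans (norm2D lf lg) _.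
have k0 : 0 <= `|K| + 2 * `|Ks| by rewrite addr_ge0// mulr_ge0.
have kd0 : 0 <= `|K| * d_Theta theta phi by exact: mulr_ge0.
rewrite norm2Z// norm2_cst -d_Theta_norm2 (ger0_norm k0) (ger0_norm kd0).
lra.
Qed.

(** This is the gradient structure: the velocity field is minus the [L^2] gradient of the energy.
    Only the upper bound is recorded, because only decrease of the energy will be used. *)
Lemma energy_taylor theta phi (k : R -> R) : k \in L2 ->
  {ae mu, forall x, phi x = theta x + to_circle (k x)} ->
  energy K Ks phi <= energy K Ks theta
    - \int[mu]_x (k x * velocity_field theta x)
    + (5 * `|K| + 4 * `|Ks|) * norm2 mu k ^+ 2.
Proof.
move=> lk phiE.
have lc := cos_Lfun2 theta; have ls := sin_Lfun2 theta.
have ls2 := sin2_Lfun2 theta; have lc2 := cos2_Lfun2 theta.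
have phiE' : {ae mu, forall x, phi x = to_circle (circle_rep (theta x) + k x)}.
  by apply: filterS phiE => x ->; rewrite to_circleD to_circle_rep.
have rE x : to_circle (circle_rep (theta x)) = theta x by exact: to_circle_rep.
pose p := \int[mu]_x (k x * circle_sin (theta x)).
pose q := \int[mu]_x (k x * circle_cos (theta x)).
pose w := \int[mu]_x (k x * circle_sin (theta x *+ 2)).
have hc : `|mcos phi - (mcos theta - p)| <= 2 * norm2 mu k ^+ 2.
  have := @int_remainder _ _ R mu (fun x => circle_cos (phi x)) _
    (\- (fun x => circle_sin (theta x))) k 2 (cos_Lfun2 phi) lc (Lfun2N ls) lk.
  rewrite [X in - (_ + X)](_ : _ = - p); last first.
    rewrite -mulN1r -RintegralZl//; last exact: mul_Lfun2_integrable.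
    by apply: eq_Rintegral => x _; rewrite /= mulrN mulN1r.
  apply => //; apply: filterS phiE' => x -> /=.
  rewrite mulrN -(rE x) circle_sinE !circle_cosE [circle_rep (to_circle _)]circle_repK.
    exact: cos_taylor.
  exact: circle_rep_itv.
have hs : `|msin phi - (msin theta + q)| <= 2 * norm2 mu k ^+ 2.
  have := @int_remainder _ _ R mu (fun x => circle_sin (phi x)) _
    (fun x => circle_cos (theta x)) k 2 (sin_Lfun2 phi) ls lc lk.
  apply => //; apply: filterS phiE' => x -> /=.
  rewrite -(rE x) circle_cosE !circle_sinE [circle_rep (to_circle _)]circle_repK.
    exact: sin_taylor.
  exact: circle_rep_itv.
have hw : `|mcos2 phi - (mcos2 theta - 2 * w)| <= 8 * norm2 mu k ^+ 2.
  have := @int_remainder _ _ R mu (fun x => circle_cos (phi x *+ 2)) _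
    ((- 2) \*: (fun x => circle_sin (theta x *+ 2))) k 8 (cos2_Lfun2 phi) lc2 (Lfun2Z _ ls2) lk.
  rewrite [X in - (Rintegral _ _ _ + X)](_ : _ = - (2 * w)); last first.
    transitivity (- 2 * w); last by rewrite mulNr.
    rewrite /w -RintegralZl//; last exact: mul_Lfun2_integrable.
    by apply: eq_Rintegral => x _; rewrite /= mulrCA.
  apply => //; apply: filterS phiE' => x -> /=.
  rewrite -(rE x) !to_circle_mul2 circle_sinE !circle_cosE [circle_rep (to_circle _)]circle_repK; last first.
    exact: circle_rep_itv.
  have := cos_taylor (2 * circle_rep (theta x)) (2 * k x).
  rewrite exprMn (mulrDr 2 (circle_rep (theta x)) (k x)); set A := cos _; set B := cos _; set C := sin _.
  have -> : 2 * (2 ^+ 2 * k x ^+ 2) = 8 * k x ^+ 2 by ring.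
  by congr (`| _ - _| <= _); rewrite /GRing.scale/=; ring.
have dle : d_Theta phi theta <= norm2 mu k by exact: d_Theta_le.
have hc' := le_trans (mcos_lip phi theta) dle.
have hs' := le_trans (msin_lip phi theta) dle.
have -> : \int[mu]_x (k x * velocity_field theta x) =
    K * (mcos theta * p - msin theta * q) - Ks * w.
  have E x : k x * velocity_field theta x =
     (K * mcos theta) * (k x * circle_sin (theta x)) +
     ((- (K * msin theta)) * (k x * circle_cos (theta x)) +
      (- Ks) * (k x * circle_sin (theta x *+ 2))).
    by rewrite /velocity_field velocityE; ring.
  under eq_Rintegral do rewrite E.
  have iZ (s : R) (g : R -> R) : g \in L2 ->
      mu.-integrable setT (EFin \o (fun x => s * (k x * g x))).
    move=> lg; rewrite (_ : _ \o _ = (fun x => s%:E * (k x * g x)%:E)%E)//.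
    by apply: integrableZl => //; exact: mul_Lfun2_integrable.
  rewrite RintegralD//; [|exact: iZ|].
    rewrite RintegralD//; [|exact: iZ..].
    rewrite !RintegralZl//; [|exact: mul_Lfun2_integrable..].
    by rewrite -/p -/q -/w; ring.
  rewrite (_ : _ \o _ = (fun x => (- (K * msin theta) * (k x * circle_cos (theta x)))%:E +
    (- Ks * (k x * circle_sin (theta x *+ 2)))%:E)%E)//.
  by apply: integrableD => //; exact: iZ.
rewrite !energyE.
have c1 := mcos_max theta; have s1 := msin_max theta.
have n0 := norm2_ge0 mu k.
set n := norm2 mu k in hc hs hw hc' hs' n0 *.
set c := mcos theta in hc c1 hc' *; set s := msin theta in hs s1 hs' *.
set m := mcos2 theta in hw *; set c' := mcos phi in hc hc' *.
set s' := msin phi in hs hs' *; set m' := mcos2 phi in hw *.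
rewrite -subr_ge0.
(* Writing [c' ^+ 2 - c ^+ 2] as [2 c (c' - c) + (c' - c) ^+ 2], and likewise for [s], isolates the
   remainders. Those of [c] and [s] cost [2 n ^+ 2] each and the squares cost [n ^+ 2], which makes
   the 5; the second harmonic costs half of 8. *)
have -> : K / 2 * (c ^+ 2 + s ^+ 2) - Ks / 2 * m - (K * (c * p - s * q) - Ks * w)
    + (5 * `|K| + 4 * `|Ks|) * n ^+ 2 - (K / 2 * (c' ^+ 2 + s' ^+ 2) - Ks / 2 * m') =
  (5 * `|K| + 4 * `|Ks|) * n ^+ 2 -
  (K * (c * (c' - (c - p)) + s * (s' - (s + q)) + ((c' - c) ^+ 2 + (s' - s) ^+ 2) / 2)
   - Ks * ((m' - (m - 2 * w)) / 2)) by field.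
rewrite subr_ge0; apply: le_trans (ler_norm _) _.
apply: le_trans (ler_normB _ _) _; rewrite !normrM.
rewrite (_ : (5 * `|K| + 4 * `|Ks|) * n ^+ 2 =
  `|K| * (5 * n ^+ 2) + `|Ks| * (4 * n ^+ 2)); last ring.
apply: lerD; last first.
  rewrite ler_wpM2l// [`|2^-1|]ger0_norm//; lra.
rewrite ler_wpM2l//.
have b1 : `|c * (c' - (c - p))| <= 2 * n ^+ 2.
  by rewrite normrM (le_trans _ hc)// ler_piMl.
have b2 : `|s * (s' - (s + q))| <= 2 * n ^+ 2.
  by rewrite normrM (le_trans _ hs)// ler_piMl.
have b3 : `|((c' - c) ^+ 2 + (s' - s) ^+ 2) / 2| <= n ^+ 2.
  rewrite ger0_norm ?divr_ge0 ?addr_ge0 ?sqr_ge0//.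
  have : (c' - c) ^+ 2 <= n ^+ 2 by rewrite -real_normK ?num_real// lerXn2r ?nnegrE.
  have : (s' - s) ^+ 2 <= n ^+ 2 by rewrite -real_normK ?num_real// lerXn2r ?nnegrE.
  lra.
apply: le_trans (ler_normD _ _) _; have := ler_normD (c * (c' - (c - p))) (s * (s' - (s + q))).
lra.
Qed.

End velocity_energy.

(** * Trajectories *)

Lemma ler_dist_sub (R : realDomainType) (a b c : R) :
  a <= b + c -> b <= a + c -> `|a - b| <= c.
Proof. by move=> ? ?; rewrite ler_distlC; apply/andP; split; lra. Qed.

(** The linear arithmetic of [dist_euler]. The last hypothesis pays for the rate [L + 1] in place of
    [L], chosen to be strictly positive as [gronwall0] asks. *)
Lemma euler_arith (R : realDomainType) (nAB nA nB nC D h L e e' : R) :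
  nAB <= nA + nB -> (1 + h * L) * nB <= (1 + h * L) * D + e' ->
  nC <= h * L * nB -> nA <= h * e -> 0 <= h * D ->
  nAB + nC <= D + h * ((L + 1) * D + e) + e'.
Proof. by move=> *; lra. Qed.

Lemma descent_arith (R : realFieldType) (E1 E0 I h n k e : R) :
  E1 <= E0 - (I + h * n) + k -> - I <= h * (e / 2) -> k <= h * (e / 2) ->
  E1 <= E0 + h * (- n + e).
Proof. by move=> *; lra. Qed.

Section trajectories.
Variables (R : realType) (K Ks : R).
Notation mu := (@lebesgue01 R).
Notation L2 := (Lfun mu 2%:E).
Variables (theta : R -> Theta R) (theta0 : Theta R) (u u' : R -> Defs.L2 R).
Hypothesis u0 : {ae mu, forall x, u 0 x = 0}.
Hypothesis u_C1 : C1_L2 u u'.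
Hypothesis theta_u : forall t : R, 0 <= t ->
  {ae mu, forall x, theta t x = theta0 x + to_circle (u t x)}.
Hypothesis u'_velocity : forall t : R, 0 <= t ->
  {ae mu, forall x, u' t x = velocity K Ks (theta t) (theta t x)}.

Let V := `|K| + `|Ks|.
Let L := `|K| + 2 * `|Ks|.
Let v t := velocity_field K Ks (theta t).

Let V_ge0 : 0 <= V. Proof. exact: addr_ge0. Qed.

Let L_ge0 : 0 <= L. Proof. by rewrite addr_ge0 ?mulr_ge0. Qed.

Let u_Lfun2 t : (u t : R -> R) \in L2. Proof. exact: LfunP. Qed.

Let v_Lfun2 t : v t \in L2. Proof. exact: velocity_field_Lfun2. Qed.

(** The only place where differentiability in time is used; clearing the division by [h] gives the
    form of increment that [dini_le] accepts. *)
Lemma first_order_expansion t e : 0 <= t -> 0 < e -> exists2 d, 0 < d &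
  forall h, 0 < `|h| < d -> 0 <= t + h ->
  norm2 mu ((u (t + h) \- u t) \- (h \*: v t)) <= `|h| * e.
Proof.
move=> t0 e0; have [/(_ t t0) u_der _] := u_C1.
have /cvgrPdist_lt/(_ e e0) := u_der.
move=> /nbhs_ballP[d /= d0 dP]; exists d => // h /andP[h0 hd] th.
have hn0 : h != 0 by rewrite -normr_gt0.
have {dP} := dP h _ hn0 th.
rewrite /ball/= sub0r normrN => /(_ hd).
rewrite sub0r normrN ger0_norm; last exact: norm2_ge0.
move=> /ltW /(ler_wpM2l (ltW h0)); apply: le_trans.
have lw : (h^-1 *: (u (t + h) - u t) - u' t : R -> R) \in L2 by exact: LfunP.
rewrite /L2_norm -/(norm2 mu _) -norm2Z//.
apply: le_norm2; [|exact: Lfun2Z|].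
  by apply: Lfun2B; [exact: Lfun2B|exact: Lfun2Z].
apply: filterS (u'_velocity t0) => x u'x; rewrite -[X in _ <= X]/(`|h * (h^-1 * (u (t + h) x - u t x) - u' t x)|).
by rewrite mulrBr mulrA mulfV// mul1r u'x.
Qed.

Let u_bound t e : 0 <= t -> 0 < e -> exists2 d, 0 < d &
  forall h, 0 < `|h| < d -> 0 <= t + h ->
  norm2 mu (u (t + h) \- u t) <= `|h| * (V + e).
Proof.
move=> t0 e0; have [d d0 H] := first_order_expansion t0 e0.
exists d => // h hd th; have HA := H h hd th.
have -> : u (t + h) \- u t = ((u (t + h) \- u t) \- (h \*: v t)) \+ (h \*: v t).
  by apply/funext => x /=; rewrite subrK.
have lhv : h \*: v t \in L2 by exact: Lfun2Z.
have lu : u (t + h) \- u t \in L2 by exact: Lfun2B.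
apply: le_trans (norm2D (Lfun2B lu lhv) lhv) _.
have : norm2 mu (h \*: v t) <= `|h| * V.
  by rewrite norm2Z// ler_wpM2l// norm2_velocity_field_le.
lra.
Qed.

Let u_cont t e : 0 <= t -> 0 < e -> exists2 d, 0 < d &
  forall s, 0 <= s -> `|t - s| < d -> norm2 mu (u s \- u t) <= e.
Proof.
move=> t0 e0; have [d d0 H] := u_bound t0 ltr01.
have V10 : 0 < V + 1 by rewrite ltr_wpDl.
exists (Num.min d (e / (V + 1))); first by rewrite lt_min d0 divr_gt0.
move=> s s0; rewrite lt_min distrC => /andP[sd se].
have [->|st] := eqVneq s t.
  apply: le_trans (ltW e0); rewrite (_ : _ \- _ = cst 0) ?norm2_cst ?normr0//.
  by apply/funext => x /=; rewrite subrr.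
have := H (s - t); rewrite (addrC t) subrK normr_gt0 subr_eq0 st sd => /(_ isT s0).
move=> h; apply: le_trans h _.
by rewrite -ler_pdivlMr// ltW.
Qed.

Let lip_le a b : 0 <= a -> a <= b -> norm2 mu (u b \- u a) <= V * (b - a).
Proof.
move=> a0 ab; have lB s t : u s \- u t \in L2 by exact: Lfun2B.
have tri r s t : norm2 mu (u r \- u t) <= norm2 mu (u s \- u t) + norm2 mu (u r \- u s).
  rewrite addrC; apply: le_trans (norm2D (lB r s) (lB s t)).
  by rewrite (_ : _ \+ _ = u r \- u t)//; apply/funext => x /=; rewrite addrA subrK.
have := @dini_le R (fun s => norm2 mu (u s \- u a)) a b V ab _ _.
have -> : norm2 mu (u a \- u a) = 0.
  rewrite (_ : _ \- _ = cst 0) ?norm2_cst ?normr0//.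
  by apply/funext => x /=; rewrite subrr.
rewrite add0r; apply.
- move=> t e /andP[at' _] e0; have [d d0 H] := u_cont (le_trans a0 at') e0.
  exists d => // s /andP[as' _] ts; have := H s (le_trans a0 as') ts.
  apply: le_trans; apply: ler_dist_sub; last exact: tri.
  rewrite (_ : norm2 mu (u s \- u t) = norm2 mu (u t \- u s)); first exact: tri.
  by rewrite -norm2N; congr norm2; apply/funext => x /=; exact: opprB.
- move=> t e /andP[at' _] e0; have [d d0 H] := u_bound (le_trans a0 at') e0.
  exists d => // h /andP[h0 hd] _; have := H h; rewrite gtr0_norm// h0 hd.
  move=> /(_ isT (addr_ge0 (le_trans a0 at') (ltW h0))).
  have := tri (t + h) t a; lra.
Qed.

Lemma u_lipschitz s t : 0 <= s -> 0 <= t ->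
  norm2 mu (u s \- u t) <= V * `|s - t|.
Proof.
move=> s0 t0; have [st|/ltW ts] := leP s t.
  rewrite distrC ger0_norm ?subr_ge0//; apply: le_trans (lip_le s0 st).
  rewrite -norm2N (_ : \- _ = u t \- u s)//.
  by apply/funext => x /=; rewrite opprB.
by rewrite ger0_norm ?subr_ge0//; exact: lip_le.
Qed.

Let theta_diff s t : 0 <= s -> 0 <= t ->
  {ae mu, forall x, theta s x = theta t x + to_circle ((u s \- u t) x)}.
Proof.
move=> s0 t0; apply: filterS2 (theta_u s0) (theta_u t0) => x -> ->.
by rewrite -addrA -to_circleD /= (addrC (u t x)) subrK.
Qed.

Lemma theta_lipschitz s t : 0 <= s -> 0 <= t ->
  d_Theta (theta s) (theta t) <= V * `|s - t|.
Proof.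
move=> s0 t0; apply: le_trans (u_lipschitz s0 t0).
apply: d_Theta_le; [exact: Lfun2B|exact: theta_diff].
Qed.

(** * Invariance of the monotone class and precompactness *)

Let r : R -> R := fun x => circle_rep (theta0 x).

Let mr : measurable_fun setT r.
Proof.
apply: (measurableT_comp (@measurable_circle_rep R)).
exact: measurable_Theta.
Qed.

Let r_Lfun2 : r \in L2.
Proof.
apply: (@bounded_Lfun2 _ _ _ mu _ (pi *+ 2) mr) => x.
by have /andP[r0 /ltW r2] := circle_rep_itv (theta0 x); rewrite ger0_norm.
Qed.

Let theta_lift t : 0 <= t ->
  {ae mu, forall x, theta t x = to_circle ((r \+ u t) x)}.
Proof.
move=> t0; apply: filterS (theta_u t0) => x ->.
by rewrite to_circleD to_circle_rep.
Qed.

(* Monotone lifts of maps of the circle, with images of length at most [2 pi]: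
   the flow map of the velocity field stays in this class. *)
Definition circle_monotone : set (R -> R) :=
  [set g | forall s t, s <= t -> g s <= g t <= g s + pi *+ 2].

Let mono_Lfun2 g : circle_monotone g -> g \o r \in L2.
Proof.
move=> gm; apply: (@bounded_Lfun2 _ _ _ mu _ (`|g 0| + pi *+ 2)).
  apply: measurableT_comp => //; apply: nondecreasing_measurable => //.
  by move=> s t /gm/andP[].
move=> x; have /andP[r0 _] := circle_rep_itv (theta0 x).
have /andP[g1 g2] := gm _ _ r0; rewrite -/(r x) in g1 g2.
have := ler_norm (g 0); have := ler_norm (- g 0); rewrite normrN /= => ? ?.
rewrite ler_norml; apply/andP; split; last lra.
have := @pi_ge0 R; lra.
Qed.

(** Euler step, on real lifts, for the motion of a point in the velocity field frozen at [phi]. *)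
Let step phi h s := s + h * velocity K Ks phi (to_circle s).

Let velocity_lip_to_circle (phi : Theta R) s t :
  `|velocity K Ks phi (to_circle s) - velocity K Ks phi (to_circle t)| <= L * `|s - t|.
Proof.
apply: le_trans (velocity_lip K Ks phi phi _ _) _.
rewrite d_Thetaxx mulr0 addr0 -to_circleB ler_wpM2l//.
exact: circle_norm_to_circle.
Qed.

Let step_homo phi h : 0 <= h -> h * L <= 1 -> {homo step phi h : s t / s <= t}.
Proof.
move=> h0 hL s t st; rewrite /step -subr_ge0.
have := le_trans (ler_norm _) (velocity_lip_to_circle phi s t).
rewrite distrC ger0_norm ?subr_ge0// => /(ler_wpM2l h0).
have : h * L * (t - s) <= t - s by rewrite ler_piMl// subr_ge0.
by rewrite -mulrA mulrBr; lra.
Qed.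

(** For [h * L <= 1] the displacement cannot reverse the order. The bound [2 pi] on increments
    survives because the step commutes with translation by [2 pi]. *)
Lemma circle_monotone_step phi h g : 0 <= h -> h * L <= 1 ->
  circle_monotone g -> circle_monotone (step phi h \o g).
Proof.
move=> h0 hL gm s t /gm/andP[g1 g2] /=; apply/andP; split.
  exact: step_homo.
have := step_homo phi h0 hL g2; rewrite {2}/step => /le_trans; apply.
have -> : to_circle (g s + pi *+ 2) = to_circle (g s).
  by apply/to_circle_eq; exists 1; rewrite mulr1.
by rewrite /step addrAC.
Qed.

Let dist t := inf [set norm2 mu ((r \+ u t) \- (g \o r)) | g in circle_monotone].

(** The identity on [0, 2 pi], where [r] takes its values, so [clamp \o r] is the lift at time 0. It
    is cut off outside because the class allows a total increase of only [2 pi]. *)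
Let clamp (s : R) := Num.max 0 (Num.min s (pi *+ 2)).

Let clamp_monotone : circle_monotone clamp.
Proof.
move=> s t st; have pi2 : 0 <= pi *+ 2 :> R by rewrite mulrn_wge0// pi_ge0.
rewrite /clamp; apply/andP; split.
  rewrite ge_max !le_max lexx/=; apply/orP; right.
  by rewrite le_min ge_min st ge_min lexx orbT.
apply: (@le_trans _ _ (pi *+ 2)); last by rewrite lerDr le_max lexx.
by rewrite ge_max pi2 ge_min lexx orbT.
Qed.

Let lift_Lfun2 t g : circle_monotone g -> (r \+ u t) \- (g \o r) \in L2.
Proof. by move=> gm; apply: Lfun2B; [exact: Lfun2D|exact: mono_Lfun2]. Qed.

Let dist_le t g : circle_monotone g ->
  dist t <= norm2 mu ((r \+ u t) \- (g \o r)).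
Proof.
by move=> gm; apply: ge_inf; [exists 0 => _ [g' _ <-]; exact: norm2_ge0|exists g].
Qed.

Let dist_has_inf t :
  has_inf [set norm2 mu ((r \+ u t) \- (g \o r)) | g in circle_monotone].
Proof.
split; first by exists (norm2 mu ((r \+ u t) \- (clamp \o r))), clamp.
by exists 0 => _ [g _ <-]; exact: norm2_ge0.
Qed.

Let dist_ge0 t : 0 <= dist t.
Proof.
apply: lb_le_inf; first exact: (dist_has_inf t).1.
by move=> _ [g _ <-]; exact: norm2_ge0.
Qed.

Let dist_approx t e : 0 < e -> exists2 g, circle_monotone g &
  norm2 mu ((r \+ u t) \- (g \o r)) < dist t + e.
Proof.
by move=> e0; have [_ [g gm <-] ge] := inf_adherent e0 (dist_has_inf t); exists g.
Qed.

Let dist_0 : dist 0 = 0.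
Proof.
apply/eqP; rewrite eq_le dist_ge0 andbT.
apply: le_trans (dist_le 0 clamp_monotone) _; apply: norm2_le => //.
  exact: lift_Lfun2.
apply: filterS u0 => x /= ->.
have /andP[r0 r2] := circle_rep_itv (theta0 x).
rewrite /clamp min_l ?(ltW r2)// max_r//.
by rewrite addr0 subrr normr0.
Qed.

Let dist_lip s t : 0 <= s -> 0 <= t -> `|dist s - dist t| <= V * `|s - t|.
Proof.
move=> s0 t0; have le a b : 0 <= a -> 0 <= b -> dist a <= dist b + V * `|a - b|.
  move=> a0 b0; apply/ler_addgt0Pr => e e0.
  have [g gm ge] := dist_approx b e0.
  apply: le_trans (dist_le a gm) _.
  have -> : (r \+ u a) \- (g \o r) = ((r \+ u b) \- (g \o r)) \+ (u a \- u b).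
    by apply/funext => x /=; ring.
  have := norm2D (lift_Lfun2 b gm) (Lfun2B (u_Lfun2 a) (u_Lfun2 b)).
  have := u_lipschitz a0 b0; lra.
by apply: ler_dist_sub; [exact: le|rewrite distrC; exact: le].
Qed.

(* An Euler step of size [h] preserves [circle_monotone] and expands distances
   by at most the factor [1 + h L]. *)
Let dist_euler t e : 0 <= t -> 0 < e -> exists2 d, 0 < d &
  forall h, 0 < h < d -> dist (t + h) <= dist t + h * ((L + 1) * dist t + e).
Proof.
move=> t0 e0; have [d d0 H] := first_order_expansion t0 e0.
have L10 : 0 < L + 1 by rewrite ltr_wpDl.
exists (Num.min d (L + 1)^-1); first by rewrite lt_min d0 invr_gt0.
move=> h; rewrite lt_min => /andP[h0 /andP[hd hL]].
have hL1 : h * L <= 1.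
  apply: (@le_trans _ _ (h * (L + 1))); first by rewrite ler_wpM2l ?(ltW h0)// lerDl.
  by rewrite -ler_pdivlMr// div1r ltW.
apply/ler_addgt0Pr => e' e'0.
have e2 : 0 < e' / (1 + h * L) by rewrite divr_gt0// ltr_wpDr// mulr_ge0// ltW.
have [g gm ge] := dist_approx t e2.
apply: le_trans (dist_le _ (circle_monotone_step (theta t) (ltW h0) hL1 gm)) _.
have th : 0 <= t + h by rewrite addr_ge0// ltW.
have := H h; rewrite gtr0_norm// h0 hd => /(_ isT th).
set A := (u (t + h) \- u t) \- (h \*: v t) => HA.
have lA : A \in L2 by apply: Lfun2B; [exact: Lfun2B|exact: Lfun2Z].
set B := (r \+ u t) \- (g \o r) in ge *.
have lB : B \in L2 by exact: lift_Lfun2.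
have lg' : (r \+ u (t + h)) \- ((step (theta t) h \o g) \o r) \in L2.
  by apply: lift_Lfun2; apply: circle_monotone_step => //; exact: ltW.
(* The error after one step splits into the time discretisation error [A], the previous error [B],
   and [C], which compares the field at the lift and at its monotone approximant and is at most
   [h * L] times [B]. *)
pose C := ((r \+ u (t + h)) \- ((step (theta t) h \o g) \o r)) \- (A \+ B).
have lC : C \in L2 by apply: Lfun2B => //; exact: Lfun2D.
have -> : (r \+ u (t + h)) \- ((step (theta t) h \o g) \o r) = (A \+ B) \+ C.
  by apply/funext => x; rewrite /C /= subrKC.
apply: le_trans (norm2D (Lfun2D lA lB) lC) _.
have HC : norm2 mu C <= h * L * norm2 mu B.
  have -> : h * L * norm2 mu B = norm2 mu ((h * L) \*: B).
    by rewrite norm2Z// ger0_norm// mulr_ge0// ltW.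
  apply: le_norm2 => //; first exact: Lfun2Z.
  apply: filterS (theta_lift t0) => x tx.
  have -> : C x = h * (velocity K Ks (theta t) (to_circle ((r \+ u t) x)) -
      velocity K Ks (theta t) (to_circle (g (r x)))).
    by rewrite -tx /C /A /B /step /v /velocity_field /= /GRing.scale /=; ring.
  rewrite normrM (gtr0_norm h0) -[X in _ <= X]/(`|h * L * B x|).
  rewrite normrM (ger0_norm (mulr_ge0 (ltW h0) L_ge0)) -mulrA.
  by apply: (ler_wpM2l (ltW h0)); exact: velocity_lip_to_circle.
have nAB := norm2D lA lB.
have hB : (1 + h * L) * norm2 mu B <= (1 + h * L) * dist t + e'.
  have hL0 : 0 < 1 + h * L by rewrite ltr_wpDr// mulr_ge0// ltW.
  have := ler_wpM2l (ltW hL0) (ltW ge).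
  rewrite (mulrDr _ (dist t)) (mulrC (1 + h * L) (e' / (1 + h * L))).
  by rewrite divfK ?gt_eqF.
have hd0 : 0 <= h * dist t by rewrite mulr_ge0// ltW.
exact: euler_arith nAB hB HC HA hd0.
Qed.

Let dist_eq0 t : 0 <= t -> dist t = 0.
Proof.
apply: (@gronwall0 R dist (L + 1) V).
- by rewrite ltr_wpDl.
- by move=> s _; exact: dist_ge0.
- exact: dist_0.
- exact: dist_lip.
- exact: dist_euler.
Qed.

Lemma trajectory_precompact : exists2 A : set (Theta R), compact A &
  forall t, 0 <= t -> A (theta t).
Proof.
have pi0 := @pi_gt0 R; have pi20 : 0 < pi *+ 2 :> R by rewrite pmulrn_lgt0.
have c0 : 0 < pi *+ 6 :> R by rewrite pmulrn_lgt0.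
have [A cA HA] := compact_monotone_images c0 mr (fun x => circle_rep_itv (theta0 x)).
(* Distance zero only puts [theta t] in the closure of the monotone images, which is enough because
   [A] is closed. *)
exists A => // t t0; apply: (compact_closed (@metric_hausdorff _ (Theta R)) cA).
move=> W /(iffLR (metricType_numDomainType.nbhs_mdistP (theta t) W))[e /= e0 eW].
have [g gm] := dist_approx t e0; rewrite dist_eq0// add0r => ge.
(* Adding a multiple of [2 pi] leaves the class in Theta unchanged. The shift [c] puts [g' 0] in
   [2 pi, 4 pi]; other values differ from it by at most [2 pi], whence the range [0, 6 pi]. *)
pose k := Num.floor (g 0 / (pi *+ 2)).
pose c : R := pi *+ 2 * (1 - k)%:~R.
have [k1 k2] : 0 <= g 0 - pi *+ 2 * k%:~R /\ g 0 - pi *+ 2 * k%:~R <= pi *+ 2.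
  have := Num.Theory.floor_itv (g 0 / (pi *+ 2)).
  rewrite -/k ler_pdivlMr// ltr_pdivrMr// intrD mulrDl mul1r => /andP[].
  by rewrite [_ * (pi *+ 2)]mulrC => ? ?; split; lra.
have cE : c = pi *+ 2 - pi *+ 2 * k%:~R by rewrite /c intrB mulrBr mulr1.
have pi6 : pi *+ 6 = 3 * (pi *+ 2) :> R by rewrite [RHS]mulr_natl -[6%N]/(2 * 3)%N mulrnA.
pose g' s := g s + c.
have g'm : {homo g' : s t / s <= t} by move=> s s' /gm/andP[? _]; rewrite lerD2r.
have g'c s : 0 <= g' s <= pi *+ 6.
  rewrite /g' cE pi6; have [/gm/andP[? ?]|/ltW/gm/andP[? ?]] := leP 0 s.
    by apply/andP; split; lra.
  by apply/andP; split; lra.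
have [|phi phiE] := @Theta_of_fun R (fun x => to_circle (g' (r x))).
  apply: (measurableT_comp (@measurable_to_circle R)).
  by apply: measurableT_comp => //; exact: nondecreasing_measurable.
exists phi; split; first exact: HA g'm g'c phiE.
apply: eW => /=; rewrite mdist_Theta; apply: le_lt_trans ge.
apply: d_Theta_le; first exact: lift_Lfun2.
apply: filterS2 (theta_lift t0) phiE => x -> ->.
rewrite -to_circleD; apply/to_circle_eq; exists (k - 1).
by rewrite /g' /= cE intrB mulrBr mulr1; ring.
Qed.

Lemma theta_continuous t e : 0 <= t -> 0 < e -> exists2 d, 0 < d &
  forall s, 0 <= s -> `|t - s| < d -> mdist (theta t) (theta s) < e.
Proof.
move=> t0 e0; have V10 : 0 < V + 1 by rewrite ltr_wpDl.
exists (e / (V + 1)); first exact: divr_gt0.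
move=> s s0; rewrite ltr_pdivlMr// mulrC => ts.
rewrite mdist_Theta; apply: le_lt_trans (theta_lipschitz t0 s0) _.
by apply: le_lt_trans ts; rewrite ler_wpM2r// lerDl.
Qed.

(** * Energy dissipation and accumulation points *)

Let E t := energy K Ks (theta t).
Let M := 5 * `|K| + 4 * `|Ks|.

(** The linear term of [energy_taylor] yields the squared norm of the velocity. Its discretisation
    error, by Cauchy-Schwarz, and the quadratic remainder, by the speed bound [V], take
    [h * (e / 2)] each, which dictates the two bounds on [h]. *)
Let E_step t e : 0 <= t -> 0 < e -> exists2 d, 0 < d &
  forall h, 0 < h < d -> E (t + h) <= E t + h * (- norm2 mu (v t) ^+ 2 + e).
Proof.
move=> t0 e0; have V10 : 0 < V + 1 by rewrite ltr_wpDl.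
have [d d0 H] := first_order_expansion t0 (divr_gt0 (divr_gt0 e0 (ltr0n R 2)) V10).
have M0 : 0 <= M by rewrite addr_ge0// mulr_ge0.
have MV0 : 0 < 2 * (M * V ^+ 2 + 1).
  by rewrite mulr_gt0// ltr_wpDl// mulr_ge0// sqr_ge0.
exists (Num.min d (e / (2 * (M * V ^+ 2 + 1)))).
  by rewrite lt_min d0 divr_gt0.
move=> h; rewrite lt_min => /andP[h0 /andP[hd he]].
have th : 0 <= t + h by rewrite addr_ge0// ltW.
have := H h; rewrite gtr0_norm// h0 hd => /(_ isT th) => HA.
pose k : R -> R := u (t + h) \- u t.
have lk : k \in L2 by exact: Lfun2B.
have := energy_taylor K Ks lk (theta_diff th t0).
rewrite -/(E t) -/(E (t + h)) -/(v t) -/M.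
have hv : h *: v t \in L2 by exact: Lfun2Z.
have lA : k \- h \*: v t \in L2 by exact: Lfun2B.
have -> : \int[mu]_x (k x * v t x) =
    \int[mu]_x ((k \- h \*: v t) x * v t x) + h * norm2 mu (v t) ^+ 2.
  rewrite -int_sqr// -RintegralZl//; last exact: Lfun2_integrable_sqr.
  rewrite -RintegralD//.
  - by apply: eq_Rintegral => x _ /=; rewrite /GRing.scale /=; ring.
  - exact: mul_Lfun2_integrable.
  - rewrite (_ : _ \o _ = (fun x => h%:E * (v t x ^+ 2)%:E)%E)//.
    by apply: integrableZl => //; exact: Lfun2_integrable_sqr.
have h1 : - (\int[mu]_x ((k \- h \*: v t) x * v t x)) <= h * (e / 2).
  rewrite lerNl; apply: le_trans (lerNnormlW (norm_int_mul lA (v_Lfun2 t))).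
  rewrite lerN2.
  have nv : norm2 mu (v t) <= V + 1.
    by apply: le_trans (norm2_velocity_field_le K Ks (theta t)) _; rewrite lerDl.
  apply: le_trans (ler_pM (norm2_ge0 _ _) (norm2_ge0 _ _) HA nv) _.
  by rewrite -(mulrA h) divfK// gt_eqF.
have h2 : M * norm2 mu k ^+ 2 <= h * (e / 2).
  have kV : norm2 mu k <= V * h.
    by have := u_lipschitz th t0; rewrite (addrAC t) subrr add0r gtr0_norm.
  have : norm2 mu k ^+ 2 <= (V * h) ^+ 2.
    by rewrite lerXn2r ?nnegrE ?norm2_ge0// mulr_ge0// ltW.
  move=> /(ler_wpM2l M0) /le_trans; apply.
  have -> : M * (V * h) ^+ 2 = h * (h * (M * V ^+ 2)) by ring.
  rewrite ler_wpM2l ?(ltW h0)//.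
  move: he; rewrite ltr_pdivlMr// mulrCA mulrDr mulr1; lra.
by move/descent_arith; apply.
Qed.

Let E_lip s t : 0 <= s -> 0 <= t ->
  `|E s - E t| <= (2 * `|K| + `|Ks|) * V * `|s - t|.
Proof.
move=> s0 t0; apply: le_trans (energy_lip K Ks _ _) _; rewrite -mulrA.
by rewrite ler_wpM2l ?addr_ge0 ?mulr_ge0//; exact: theta_lipschitz.
Qed.

(** With [m = 0] this is monotonicity of the energy; with [m > 0] it is the quantitative loss behind
    [accumulation_fixed]. *)
Lemma energy_drop a b m : 0 <= a -> a <= b -> 0 <= m ->
  (forall t, a <= t <= b -> m <= norm2 mu (v t)) ->
  energy K Ks (theta b) <= energy K Ks (theta a) - m ^+ 2 * (b - a).
Proof.
move=> a0 ab m0 mv; rewrite -mulNr; apply: (@dini_le R E) => //.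
- move=> t e /andP[at' _] e0; pose C := (2 * `|K| + `|Ks|) * V.
  have C0 : 0 <= C by rewrite mulr_ge0// addr_ge0// mulr_ge0.
  have C10 : 0 < C + 1 by rewrite ltr_wpDl.
  exists (e / (C + 1)); first exact: divr_gt0.
  move=> s /andP[as' _]; rewrite ltr_pdivlMr// mulrC => ts.
  apply: le_trans (E_lip (le_trans a0 at') (le_trans a0 as')) _.
  by apply: le_trans (ltW ts); rewrite ler_wpM2r// lerDl.
move=> t e /andP[at' tb] e0; have [d d0 H] := E_step (le_trans a0 at') e0.
exists d => // h hd _; have /andP[h0 _] := hd.
apply: le_trans (H h hd) _; rewrite lerD2l ler_wpM2l ?(ltW h0)// lerD2r lerN2.
by rewrite lerXn2r ?nnegrE ?norm2_ge0// mv// at' ltW.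
Qed.

Let energy_inf := inf [set E t | t in [set t | 0 <= t]].

Let energy_has_inf : has_inf [set E t | t in [set t | 0 <= t]].
Proof.
split; first by exists (E 0), 0 => /=.
by exists (- V) => _ [t _ <-]; exact: energy_ge.
Qed.

Let energy_inf_le t : 0 <= t -> energy_inf <= E t.
Proof. by move=> t0; apply: ge_inf; [exact: energy_has_inf.2|exists t]. Qed.

Let energy_cvg e : 0 < e -> exists2 T, 0 <= T &
  forall t, T <= t -> E t < energy_inf + e.
Proof.
move=> e0; have [_ [T /= T0 <-] ET] := inf_adherent e0 energy_has_inf.
exists T => // t Tt; apply: le_lt_trans ET.
have := energy_drop T0 Tt (lexx 0) (fun _ _ => norm2_ge0 _ _).
by rewrite expr0n mul0r subr0.
Qed.

(** The energy decreases along the trajectory to its infimum there, and it is Lipschitz on Theta, so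
    this limit passes to every accumulation point. *)
Lemma accumulation_energy p : accumulation_points theta p ->
  energy K Ks p = energy_inf.
Proof.
move=> /omega_limitP Hp; apply/eqP; rewrite -subr_eq0 -normr_le0.
apply/ler_addgt0Pr => e e0; rewrite add0r.
have [T T0 HT] := energy_cvg (divr_gt0 e0 (ltr0n R 2)).
pose C := 2 * `|K| + `|Ks|.
have C0 : 0 <= C by rewrite addr_ge0// mulr_ge0.
have C10 : 0 < C + 1 by rewrite ltr_wpDl.
have [|t [t0 Tt]] := Hp T (e / 2 / (C + 1)); first by rewrite !divr_gt0.
rewrite mdist_Theta ltr_pdivlMr// mulrC => pt.
have h1 := energy_lip K Ks p (theta t).
have h2 := HT t Tt; have h3 := energy_inf_le t0.
have h4 : C * d_Theta p (theta t) <= (C + 1) * d_Theta p (theta t).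
  by rewrite ler_wpM2r ?lerDl// -mdist_Theta mdist_ge0.
have h5 : `|E t - energy_inf| <= e / 2 by rewrite ger0_norm ?subr_ge0//; lra.
rewrite (_ : _ - _ = (energy K Ks p - E t) + (E t - energy_inf)); last ring.
apply: le_trans (ler_normD _ _) _; rewrite (splitr e) lerD//.
exact: le_trans h1 (le_trans h4 (ltW pt)).
Qed.

(** If the velocity at [p] had norm [m > 0], late visits near [p] would each last a fixed time at
    velocity norm at least [m / 2], and one of them would cost more energy than is left above the
    infimum. *)
Lemma accumulation_fixed p : accumulation_points theta p ->
  fixed_points K Ks p.
Proof.
move=> /omega_limitP Hp; have lp := velocity_field_Lfun2 K Ks p.
suff : norm2 mu (velocity_field K Ks p) = 0 by move/(norm2_eq0 lp).
apply/eqP; rewrite eq_le norm2_ge0 andbT leNgt; apply/negP.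
set m := norm2 mu _ => m0.
have V10 : 0 < V + 1 by rewrite ltr_wpDl.
(* Moving by [q] changes the velocity norm by at most [m / 4], and in time [tau] the trajectory
   moves by at most [q]. Two such losses, from [p] to [theta t] and on to [theta s], leave
   [m / 2]. *)
pose q := m / 4 / (2 * (V + 1)).
have q0 : 0 < q by rewrite !divr_gt0// mulr_gt0.
pose tau := q / (V + 1).
have tau0 : 0 < tau by rewrite divr_gt0.
have drop0 : 0 < (m / 2) ^+ 2 * tau by rewrite mulr_gt0// exprn_gt0// divr_gt0.
have [T T0 HT] := energy_cvg drop0.
have [t [t0 Tt] pt] := Hp T q q0.
have Vd phi psi : d_Theta phi psi <= q ->
    norm2 mu (velocity_field K Ks phi) <= norm2 mu (velocity_field K Ks psi) + m / 4.
  move=> dq; apply: le_trans (norm2_velocity_field_lip K Ks phi psi) _.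
  rewrite lerD2l -/V; apply: (@le_trans _ _ (2 * (V + 1) * q)).
    apply: ler_pM => //; first by rewrite mulr_ge0.
      by rewrite -mdist_Theta mdist_ge0.
    by rewrite ler_wpM2l// lerDl.
  by rewrite /q mulrC divfK// gt_eqF// mulr_gt0.
have mv s : t <= s <= t + tau -> m / 2 <= norm2 mu (v s).
  move=> /andP[ts st]; have h1 := Vd p (theta t) (ltW pt).
  have s0 := le_trans t0 ts.
  have : d_Theta (theta t) (theta s) <= q.
    apply: le_trans (theta_lipschitz t0 s0) _.
    rewrite distrC ger0_norm ?subr_ge0//.
    apply: (@le_trans _ _ ((V + 1) * tau)); last by rewrite mulrC divfK// gt_eqF.
    apply: ler_pM => //; first by rewrite subr_ge0.
      by rewrite lerDl.
    by rewrite lerBlDl.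
  by move=> /Vd; rewrite -/(v t) -/(v s); rewrite -/m -/(v t) in h1; lra.
have := energy_drop t0 (_ : t <= t + tau) (ltW (divr_gt0 m0 (ltr0n R 2))) mv.
rewrite lerDl (ltW tau0) => /(_ isT); rewrite -/(E _) -/(E _).
have := HT t Tt; have := energy_inf_le (addr_ge0 t0 (ltW tau0)).
rewrite (addrAC t) subrr add0r; lra.
Qed.

Lemma accumulation_points_structure :
  [/\ accumulation_points theta !=set0,
      compact (accumulation_points theta),
      connected (accumulation_points theta),
      accumulation_points theta `<=` fixed_points K Ks &
      exists c : R, accumulation_points theta `<=`
        [set theta_star | energy K Ks theta_star = c]].
Proof.
have [A cA HA] := trajectory_precompact.
split.
- exact: omega_limit_neq0 cA HA.
- exact: omega_limit_compact cA HA.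
- exact: omega_limit_connected cA HA theta_continuous.
- exact: accumulation_fixed.
- by exists energy_inf => p; exact: accumulation_energy.
Qed.

End trajectories.

Theorem lemma3p14 (R : realType) (K Ks : R) (Ks_gt0 : 0 < Ks)
    (theta : R -> Theta R) (theta_traj : trajectory K Ks theta) :
  [/\ accumulation_points theta !=set0,
      compact (accumulation_points theta),
      connected (accumulation_points theta),
      accumulation_points theta `<=` fixed_points K Ks &
      exists c : R, accumulation_points theta `<=`
        [set theta_star | energy K Ks theta_star = c]].
Proof.
have [theta0 [u [u' [u0 u_C1 theta_u u'_v]]]] := theta_traj.
exact: accumulation_points_structure u0 u_C1 theta_u u'_v.
Qed.
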